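(* Let $P(\theta)=\sum_{l=-L}^{L}a_le^{il\theta}$ be the generating function of an isotropic continuous-time quantum walk with finite support on $\mathbb{Z}$, and assume that the walk is started from the origin, i.e. the initial function is $\delta_0$. Let $\alpha=l/t$ and suppose that the equation $P'(\theta)=-\alpha$ has $K>0$ real solutions $\theta_k=\theta_k(\alpha)$, $k=1,\dots,K$, in the interval $[0,2\pi)$. Then the transition amplitude from $0$ to $l$ is given by the formula $$\psi_l(t)=-\frac{1}{\sqrt{2\pi t}}\sum_{k=1}^{K}\frac{1}{\sqrt{|P''(\theta_k)|}}\,e^{it\left(P(\theta_k)+\alpha\theta_k\right)\pm\pi i/4}+O\!\left(\frac1t\right),$$ where the sign before $\pi i/4$ equals the sign of $P''(\theta_k)$. If the equation $P'(\theta)=-\alpha$ has no real solutions, then $$|\psi_l(t)|\le c_nt^{-n}$$ for all $n$ and appropriately chosen $c_n$.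
   Context: Let $\delta_l$, $l\in\mathbb{Z}$, be the delta function on $\mathbb{Z}$ concentrated at $l$, regarded as an element of $L^2(\mathbb{Z})=\ell^2(\mathbb{Z})$. A quantum walk on $\mathbb{Z}$ is given by a Hermitian operator $X$ on $L^2(\mathbb{Z})$ with matrix entries $X_{ij}$ and has evolution $U_t=\exp(itX)$; its transition amplitudes from $0$ are $\psi_l(t)=\langle\delta_l,U_t\delta_0\rangle=\sum_{k\ge0}(X^k)_{0l}(it)^k/k!$. The walk has finite support if there is a constant $L$ such that $X_{ij}=0$ whenever $|i-j|>L$. It is isotropic if $X_{ij}=a_{i-j}$ and $a_{-l}=\overline{a_l}$ for certain constants $a_l$. The asymptotic statements refer to $t\to\infty$ with $\alpha=l/t$ held fixed ($l$ an integer).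
   Formalization: The prefactor is +1/√(2πt) instead of the printed −1/√(2πt), which is false (P=cos, α=l=0 gives J_0(t)), and P''(θ_k)≠0 is assumed for every k, without which the formula is undefined. *)

(* Defs.v *)
From Stdlib Require Import Reals ZArith Lia Lra.
From Coquelicot Require Import Coquelicot.
Open Scope R_scope.

Definition expi (x : R) : C := (cos x, sin x).

(* \sum_{l=-L}^{L} f l *)
Definition zsum (L : nat) (f : Z -> C) : C :=
  sum_n (fun k : nat => f (Z.of_nat k - Z.of_nat L)%Z) (2 * L).

Definition hermitian (X : Z -> Z -> C) : Prop :=
  forall i j : Z, X j i = Cconj (X i j).

Definition finite_support (X : Z -> Z -> C) (L : nat) : Prop :=
  forall i j : Z, (Z.of_nat L < Z.abs (i - j))%Z -> X i j = RtoC 0.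

Definition isotropic (X : Z -> Z -> C) (a : Z -> C) : Prop :=
  (forall i j : Z, X i j = a (i - j)%Z) /\
  (forall l : Z, a (- l)%Z = Cconj (a l)).

(* (X^k)_{ij} for a matrix with [finite_support X L]: the only nonzero terms of
   \sum_{m \in Z} (X^k)_{im} X_{mj} are those with |m - j| <= L. *)
Fixpoint mxpow (L : nat) (X : Z -> Z -> C) (k : nat) (i j : Z) : C :=
  match k with
  | O => if Z.eq_dec i j then RtoC 1 else RtoC 0
  | S k' => zsum L (fun d => Cmult (mxpow L X k' i (j + d)%Z) (X (j + d)%Z j))
  end.

Definition amplitude_term (L : nat) (X : Z -> Z -> C) (l : Z) (t : R) (k : nat) : C :=
  Cdiv (Cmult (mxpow L X k 0%Z l) (Cpow (Cmult Ci (RtoC t)) k))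
       (RtoC (INR (fact k))).

(* \psi_l(t) = \sum_k (X^k)_{0l} (it)^k / k!, summed componentwise because
   [Series] is real-valued; see [amplitude_is_series]. *)
Definition amplitude (L : nat) (X : Z -> Z -> C) (l : Z) (t : R) : C :=
  (Series (fun k => Re (amplitude_term L X l t k)),
   Series (fun k => Im (amplitude_term L X l t k))).

Definition gen_fun (L : nat) (a : Z -> C) (theta : R) : C :=
  zsum L (fun l => Cmult (a l) (expi (IZR l * theta))).

(* P as a real function, so that [Derive] applies; see [gen_fun_real]. *)
Definition genP (L : nat) (a : Z -> C) (theta : R) : R := Re (gen_fun L a theta).

Definition stationary_points (L : nat) (a : Z -> C) (alpha : R)
    (K : nat) (theta : nat -> R) : Prop :=
  (forall k, (1 <= k <= K)%nat ->
     0 <= theta k < 2 * PI /\ Derive (genP L a) (theta k) = - alpha) /\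
  (forall j k, (1 <= j <= K)%nat -> (1 <= k <= K)%nat ->
     theta j = theta k -> j = k) /\
  (forall x, 0 <= x < 2 * PI -> Derive (genP L a) x = - alpha ->
     exists k, (1 <= k <= K)%nat /\ theta k = x).

(* The prefactor is positive: for P = cos and l = 0 the amplitude is the Bessel
   function J_0(t), which is asymptotic to sqrt (2 / (PI t)) cos (t - PI / 4). *)
Definition leading_term (L : nat) (a : Z -> C) (alpha : R)
    (K : nat) (theta : nat -> R) (t : R) : C :=
  Cmult (RtoC (1 / sqrt (2 * PI * t)))
    (sum_n_m (fun k =>
       Cmult (RtoC (1 / sqrt (Rabs (Derive_n (genP L a) 2 (theta k)))))
             (expi (t * (genP L a (theta k) + alpha * theta k)
                    + sign (Derive_n (genP L a) 2 (theta k)) * (PI / 4))))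
       1 K).

Lemma sum_n_rev (f : nat -> C) (n : nat) :
  sum_n f n = sum_n (fun k => f (n - k)%nat) n.
Proof.
revert f; induction n as [|n IH]; intros f.
- now rewrite !sum_O.
- rewrite sum_Sn, IH. unfold sum_n at 2. rewrite sum_Sn_m by lia.
  rewrite <- sum_n_m_S. rewrite plus_comm.
  f_equal.
Qed.

Lemma zsum_opp (L : nat) (f : Z -> C) : zsum L (fun l => f (- l)%Z) = zsum L f.
Proof.
unfold zsum. rewrite sum_n_rev. apply sum_n_ext_loc. intros k Hk.
f_equal. lia.
Qed.

Lemma zsum_conj (L : nat) (f : Z -> C) :
  Cconj (zsum L f) = zsum L (fun l => Cconj (f l)).
Proof.
unfold zsum. generalize (2 * L)%nat as n. induction n as [|n IH].
- now rewrite !sum_O.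
- rewrite !sum_Sn, <- IH. apply Cplus_conj.
Qed.

Lemma gen_fun_real (X : Z -> Z -> C) (L : nat) (a : Z -> C) (theta : R) :
  isotropic X a -> gen_fun L a theta = RtoC (genP L a theta).
Proof.
intros [_ Ha].
assert (H : Cconj (gen_fun L a theta) = gen_fun L a theta).
{ unfold gen_fun. rewrite zsum_conj, <- zsum_opp. unfold zsum.
  apply sum_n_ext. intros k. rewrite Cmult_conj, Ha, Cconj_conj. f_equal.
  unfold expi, Cconj; simpl. rewrite opp_IZR, Ropp_mult_distr_l_reverse.
  now rewrite cos_neg, sin_neg, Ropp_involutive. }
unfold genP. destruct (gen_fun L a theta) as [x y].
unfold Cconj in H; simpl in H. injection H as H.
unfold RtoC, Re; simpl. f_equal. lra.
Qed.

Lemma Cmod_zsum (L : nat) (f : Z -> C) (g : Z -> R) :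
  (forall l, Cmod (f l) <= g l) ->
  Cmod (zsum L f) <= sum_n (fun k : nat => g (Z.of_nat k - Z.of_nat L)%Z) (2 * L).
Proof.
intros H. unfold zsum. generalize (2 * L)%nat as n. induction n as [|n IH].
- rewrite !sum_O. apply H.
- rewrite !sum_Sn. eapply Rle_trans; [apply Cmod_triangle|].
  apply Rplus_le_compat; [exact IH | apply H].
Qed.

Lemma Cmod_mxpow (X : Z -> Z -> C) (L : nat) (a : Z -> C) (k : nat) (i j : Z) :
  isotropic X a ->
  Cmod (mxpow L X k i j) <=
  sum_n (fun k : nat => Cmod (a (Z.of_nat k - Z.of_nat L)%Z)) (2 * L) ^ k.
Proof.
intros [HX _]. revert j. induction k as [|k IH]; intros j.
- simpl. destruct (Z.eq_dec i j); rewrite ?Cmod_1, ?Cmod_0; lra.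
- set (M := sum_n _ _) in *. cbn [mxpow].
  eapply Rle_trans.
  + apply Cmod_zsum with (g := fun d => M ^ k * Cmod (a d)). intros d.
    rewrite Cmod_mult, HX. replace (j + d - j)%Z with d by lia.
    apply Rmult_le_compat_r; [apply Cmod_ge_0 | apply IH].
  + right. etransitivity.
    * exact (@sum_n_mult_l R_Ring (M ^ k)
        (fun k0 : nat => Cmod (a (Z.of_nat k0 - Z.of_nat L)%Z)) (2 * L)).
    * apply Rmult_comm.
Qed.

Lemma ex_series_amplitude (X : Z -> Z -> C) (L : nat) (a : Z -> C) (l : Z) (t : R) :
  isotropic X a -> ex_series (fun k => Cmod (amplitude_term L X l t k)).
Proof.
intros HX.
set (M := sum_n (fun k : nat => Cmod (a (Z.of_nat k - Z.of_nat L)%Z)) (2 * L)).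
apply (@ex_series_le R_AbsRing R_CompleteNormedModule _
  (fun k => / INR (fact k) * (M * Rabs t) ^ k)).
- intros k. change (Rabs (Cmod (amplitude_term L X l t k)) <= / INR (fact k) * (M * Rabs t) ^ k).
  rewrite Rabs_pos_eq by apply Cmod_ge_0.
  assert (Hf : 0 < INR (fact k)) by apply INR_fact_lt_0.
  unfold amplitude_term. rewrite Cmod_div
    by (intros E; apply RtoC_inj in E; lra).
  rewrite Cmod_R, (Rabs_pos_eq (INR _)) by lra.
  rewrite Cmod_mult, Cmod_pow, Cmod_mult, Cmod_R.
  replace (Cmod Ci) with 1.
  2: { unfold Cmod, Ci; simpl. rewrite <- sqrt_1 at 1. apply f_equal. ring. }
  rewrite Rmult_1_l, Rpow_mult_distr. unfold Rdiv. rewrite Rmult_comm.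
  apply Rmult_le_compat_l; [left; now apply Rinv_0_lt_compat|].
  apply Rmult_le_compat_r; [apply pow_le, Rabs_pos | now apply Cmod_mxpow].
- exists (exp (M * Rabs t)). 
  apply (is_series_ext (fun k => (M * Rabs t) ^ k * / INR (fact k))).
  + intros k. apply Rmult_comm.
  + generalize (is_exp_Reals (M * Rabs t)). unfold is_pseries.
    apply is_series_ext. intros k. now rewrite pow_n_pow.
Qed.

Lemma amplitude_is_series (X : Z -> Z -> C) (L : nat) (a : Z -> C) (l : Z) (t : R) :
  isotropic X a ->
  is_series (V := C_R_NormedModule) (amplitude_term L X l t) (amplitude L X l t).
Proof.
intros HX.
assert (H := ex_series_amplitude X L a l t HX).
assert (HR : is_series (fun k => Re (amplitude_term L X l t k))
               (Series (fun k => Re (amplitude_term L X l t k)))).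
{ apply Series_correct, ex_series_Rabs.
  refine (@ex_series_le R_AbsRing R_CompleteNormedModule _ _ _ H).
  intros k. change (Rabs (Rabs (Re (amplitude_term L X l t k)))
    <= Cmod (amplitude_term L X l t k)).
  rewrite Rabs_Rabsolu. apply re_le_Cmod. }
assert (HI : is_series (fun k => Im (amplitude_term L X l t k))
               (Series (fun k => Im (amplitude_term L X l t k)))).
{ apply Series_correct, ex_series_Rabs.
  refine (@ex_series_le R_AbsRing R_CompleteNormedModule _ _ _ H).
  intros k. change (Rabs (Rabs (Im (amplitude_term L X l t k)))
    <= Cmod (amplitude_term L X l t k)).
  rewrite Rabs_Rabsolu. eapply Rle_trans; [apply Rmax_r | apply Rmax_Cmod]. }
unfold is_series in *.
assert (E : forall n, sum_n (G := C_R_NormedModule) (amplitude_term L X l t) n =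
   (sum_n (fun k => Re (amplitude_term L X l t k)) n,
    sum_n (fun k => Im (amplitude_term L X l t k)) n)).
{ induction n as [|n IH].
  - rewrite !sum_O. now destruct (amplitude_term L X l t 0).
  - rewrite !sum_Sn, IH. reflexivity. }
apply (filterlim_ext (fun n =>
   (sum_n (fun k => Re (amplitude_term L X l t k)) n,
    sum_n (fun k => Im (amplitude_term L X l t k)) n))).
{ intros n. now rewrite E. }
intros Q [eps HQ].
generalize (HR _ (locally_ball _ eps)) (HI _ (locally_ball _ eps)).
intros H1 H2. unfold filtermap in *.
generalize (filter_and _ _ H1 H2). apply filter_imp.
intros n [A B]. apply HQ. now split.
Qed.

(* Main.v *)
Require Import Defs.
From Stdlib Require Import Reals ZArith Lra Lia.
From Coquelicot Require Import Coquelicot.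
Open Scope R_scope.

(** The amplitude is the Fourier integral
    [1 / (2 PI) int_0^(2 PI) exp (i t phi)] of the phase
    [phi x = P x + alpha * x], because the powers of the convolution operator [X]
    are the Fourier coefficients of the powers of its symbol [P]
    ([mxpow_Fourier], [amplitude_dispersion_integral]).  The rest is the method of
    stationary phase.  Real and imaginary parts are treated together, as
    integrals of [cos (t * phi + beta)] with a bound uniform in [beta].

    Where [phi'] does not vanish, integration by parts ([oscillating_by_parts])
    gains a factor [1 / t].  If it vanishes nowhere, there are no boundary terms
    on the circle ([t * alpha] is an integer), and repeating the step gives every
    power of [1 / t] ([nonstationary_periodic]).

    At a stationary point with [phi'' > 0], the Morse coordinate [u] defined by
    [phi = phi x0 + u ^ 2] is smooth, and [1 = kappa * u' + B * phi'] with [kappa]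
    a constant and [B] of class C^1.  The first summand integrates exactly to a
    Fresnel integral, the second is [O (1 / t)] by parts
    ([half_stationary_phase]); smoothness of [u] and [B] at [x0] rests on
    Hadamard's lemma ([Hadamard_quotient]).  The Fresnel integral itself, with
    error [O (1 / x)], comes from an identity for its square
    ([fresnel_square], [fresnel_asymptotic]).

    These estimates are made on each side of a point separately, and each is
    valid on short segments only.  Both sides of the claim, the integral and a
    step function [G] collecting the stationary terms, are additive in the
    segment, so that continuous induction ([segment_induction]) extends the
    estimate to the whole period ([stationary_phase_interval],
    [stationary_phase_dispersion]). *)

(** * Functions of class C^n *)

(** Class C^n, by recursion on the order instead of through [Derive_n]: the
    closure properties below are then plain inductions, with no Leibniz formula
    for higher derivatives. *)
Fixpoint class_C (D : R -> Prop) (n : nat) (f : R -> R) : Prop :=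
  match n with
  | O => forall x, D x -> continuous f x
  | S m => exists f' : R -> R,
      (forall x, D x -> is_derive f x (f' x)) /\ class_C D m f'
  end.

Definition everywhere (x : R) : Prop := True.

Lemma is_derive_continuous (f : R -> R) (x l : R) :
  is_derive f x l -> continuous f x.
Proof.
intros H. apply (@ex_derive_continuous R_AbsRing R_NormedModule). now exists l.
Qed.

Lemma class_C_continuous D n f x : class_C D n f -> D x -> continuous f x.
Proof.
destruct n as [|n]; [now auto|].
intros [f' [H _]] Hx. exact (is_derive_continuous _ _ _ (H x Hx)).
Qed.

Lemma class_C_pred D n f : class_C D (S n) f -> class_C D n f.
Proof.
revert f; induction n as [|n IH]; intros f H.
- intros x. now apply (class_C_continuous D 1).
- destruct H as [f' [H H']]. exists f'. split; [exact H | now apply IH].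
Qed.

Lemma class_C_ext D n f g :
  (forall x, f x = g x) -> class_C D n f -> class_C D n g.
Proof.
intros E. destruct n as [|n].
- intros H x Hx. apply (continuous_ext f); [exact E | now apply H].
- intros [f' [H H']]. exists f'. split; [|exact H'].
  intros x Hx. apply (is_derive_ext f); [exact E | now apply H].
Qed.

Lemma class_C_restrict (D D' : R -> Prop) n f :
  (forall x, D x -> D' x) -> class_C D' n f -> class_C D n f.
Proof.
intros I. revert f; induction n as [|n IH]; intros f.
- intros H x Hx. now apply H, I.
- intros [f' [H H']]. exists f'. split; [|now apply IH].
  intros x Hx. now apply H, I.
Qed.

Lemma class_C_const D n c : class_C D n (fun _ => c).
Proof.
revert c; induction n as [|n IH]; intros c.
- intros x _. apply continuous_const.
- exists (fun _ => 0). split; [|apply IH]. intros x _. apply @is_derive_const.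
Qed.

Lemma class_C_id D n : class_C D n (fun x => x).
Proof.
destruct n as [|n].
- intros x _. apply continuous_id.
- exists (fun _ => 1). split; [|apply class_C_const]. intros x _. apply @is_derive_id.
Qed.

Lemma class_C_plus D n f g :
  class_C D n f -> class_C D n g -> class_C D n (fun x => f x + g x).
Proof.
revert f g; induction n as [|n IH]; intros f g.
- intros Hf Hg x Hx. apply @continuous_plus; auto.
- intros [f' [Hf Hf']] [g' [Hg Hg']]. exists (fun x => f' x + g' x).
  split; [|now apply IH]. intros x Hx. apply @is_derive_plus; auto.
Qed.

Lemma class_C_mult D n f g :
  class_C D n f -> class_C D n g -> class_C D n (fun x => f x * g x).
Proof.
revert f g; induction n as [|n IH]; intros f g.
- intros Hf Hg x Hx. apply @continuous_mult; auto.
- intros Hf Hg. pose proof (class_C_pred _ _ _ Hf) as Hf0.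
  pose proof (class_C_pred _ _ _ Hg) as Hg0.
  destruct Hf as [f' [Hf Hf']], Hg as [g' [Hg Hg']].
  exists (fun x => f' x * g x + f x * g' x). split.
  + intros x Hx. apply is_derive_Reals, derivable_pt_lim_mult; apply is_derive_Reals; auto.
  + apply class_C_plus; now apply IH.
Qed.

Lemma class_C_scal D n c f : class_C D n f -> class_C D n (fun x => c * f x).
Proof. intros H. apply class_C_mult; [apply class_C_const | exact H]. Qed.

Lemma class_C_inv D n f :
  (forall x, D x -> f x <> 0) -> class_C D n f -> class_C D n (fun x => / f x).
Proof.
intros Hnz. revert Hnz; induction n as [|n IH]; intros Hnz Hf.
- intros x Hx. apply continuous_Rinv_comp; auto.
- assert (Hi := IH Hnz (class_C_pred _ _ _ Hf)).
  destruct Hf as [f' [Hf Hf']].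
  exists (fun x => -1 * (f' x * (/ f x * / f x))). split.
  + intros x Hx. replace (-1 * _) with (- f' x / f x ^ 2).
    * apply is_derive_inv; auto.
    * field. auto.
  + apply class_C_scal, class_C_mult; [exact Hf'|]. now apply class_C_mult.
Qed.

Lemma class_C_div D n f g :
  (forall x, D x -> g x <> 0) -> class_C D n f -> class_C D n g ->
  class_C D n (fun x => f x / g x).
Proof. intros Hnz Hf Hg. apply class_C_mult; [exact Hf | now apply class_C_inv]. Qed.

Lemma class_C_sqrt D n f :
  (forall x, D x -> 0 < f x) -> class_C D n f -> class_C D n (fun x => sqrt (f x)).
Proof.
intros Hp. induction n as [|n IH]; intros Hf.
- intros x Hx. apply continuous_sqrt_comp; auto.
- assert (Hi := IH (class_C_pred _ _ _ Hf)).
  destruct Hf as [f' [Hf Hf']].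
  exists (fun x => f' x / (2 * sqrt (f x))). split.
  + intros x Hx. apply is_derive_sqrt; auto.
  + apply class_C_div; [|exact Hf'|now apply class_C_scal].
    intros x Hx. apply Rgt_not_eq, Rmult_lt_0_compat; [lra|]. apply sqrt_lt_R0. auto.
Qed.

Lemma class_C_comp_affine n f c e :
  class_C everywhere n f -> class_C everywhere n (fun s => f (c + e * s)).
Proof.
revert f; induction n as [|n IH]; intros f.
- intros H x _. apply (continuous_comp (fun s => c + e * s) f); [|now apply H].
  apply (is_derive_continuous _ _ e). auto_derive; [easy | ring].
- intros [f' [H H']]. exists (fun s => e * f' (c + e * s)). split.
  + intros x _. apply (is_derive_comp f (fun s => c + e * s)); [now apply H|].
    auto_derive; [easy | ring].
  + apply class_C_scal. now apply IH.
Qed.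

Lemma class_C_cos_affine D n c d : class_C D n (fun x => cos (c * x + d)).
Proof.
revert d; induction n as [|n IH]; intros d.
- intros x _. apply (is_derive_continuous _ _ (- (c * sin (c * x + d)))).
  auto_derive; [easy | ring].
- exists (fun x => c * cos (c * x + (d + PI / 2))). split.
  + intros x _. auto_derive; [easy|].
    replace (c * x + (d + PI / 2)) with (PI / 2 + (c * x + d)) by ring.
    rewrite <- sin_shift. rewrite <- sin_neg. rewrite Rmult_1_r.
    f_equal. f_equal. ring.
  + apply class_C_scal, IH.
Qed.

Lemma class_C_sum D n (f : nat -> R -> R) N :
  (forall k, class_C D n (f k)) -> class_C D n (fun x => sum_n (fun k => f k x) N).
Proof.
intros H. induction N as [|N IH].
- apply (class_C_ext _ _ (f 0%nat)); [|apply H]. intros x. now rewrite sum_O.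
- apply (class_C_ext _ _ (fun x => sum_n (fun k => f k x) N + f (S N) x)).
  + intros x. now rewrite sum_Sn.
  + now apply class_C_plus.
Qed.

(** Differentiation under the integral sign, in the form used both for Hadamard
    quotients and for the Fresnel integral. *)
Lemma is_derive_RInt_parameter (f df : R -> R -> R) (a b x : R) :
  (forall u v, is_derive (fun z => f z v) u (df u v)) ->
  (forall u v, continuous (f u) v) ->
  (forall u v, continuity_2d_pt df u v) ->
  is_derive (fun u => RInt (f u) a b) x (RInt (df x) a b).
Proof.
intros Hd Hc H2.
replace (RInt (df x) a b) with (RInt (fun t => Derive (fun u => f u t) x) a b).
2: { apply RInt_ext. intros t _. apply is_derive_unique, Hd. }
apply (is_derive_RInt_param f).
- apply filter_forall. intros u t _. exists (df u t). apply Hd.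
- intros t _. apply (continuity_2d_pt_ext df); [|apply H2].
  intros u v. symmetry. apply is_derive_unique, Hd.
- apply filter_forall. intros u. apply @ex_RInt_continuous. intros z _. apply Hc.
Qed.

Lemma is_derive_RInt_scaled k f f' s :
  (forall x, is_derive f x (f' x)) -> (forall x, continuous f' x) ->
  is_derive (fun s => RInt (fun v => v ^ k * f (s * v)) 0 1) s
            (RInt (fun v => v ^ S k * f' (s * v)) 0 1).
Proof.
intros Hf Hf'.
assert (Hpow : forall (j : nat) (v : R), continuous (fun z : R => z ^ j) v).
{ intros j v. apply (is_derive_continuous _ _ (INR j * v ^ pred j)).
  auto_derive; [easy | ring]. }
apply (is_derive_RInt_parameter (fun u v => v ^ k * f (u * v))
        (fun u v => v ^ S k * f' (u * v))).
- intros u v. replace (v ^ S k * f' (u * v)) with (v ^ k * (v * f' (u * v)))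
    by (simpl; ring).
  apply is_derive_scal. apply (is_derive_comp f (fun z => z * v)); [apply Hf|].
  auto_derive; [easy | ring].
- intros u v. apply (@continuous_mult _ R_AbsRing); [apply Hpow|].
  apply (continuous_comp (fun v => u * v) f).
  + apply (is_derive_continuous _ _ u). auto_derive; [easy | ring].
  + exact (is_derive_continuous _ _ _ (Hf _)).
- intros u v. apply continuity_2d_pt_mult.
  + apply (continuity_1d_2d_pt_comp (fun z => z ^ S k));
      [apply continuity_pt_filterlim, Hpow | apply continuity_2d_pt_id2].
  + apply (continuity_1d_2d_pt_comp f');
      [apply continuity_pt_filterlim, Hf'|].
    apply continuity_2d_pt_mult; [apply continuity_2d_pt_id1|apply continuity_2d_pt_id2].
Qed.

Lemma class_C_RInt_scaled n k f :
  class_C everywhere (S n) f ->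
  class_C everywhere n (fun s => RInt (fun v => v ^ k * f (s * v)) 0 1).
Proof.
revert k f; induction n as [|n IH]; intros k f [f' [Hf Hf']].
- intros s _. eapply is_derive_continuous, is_derive_RInt_scaled.
  + intros x. now apply Hf.
  + intros x. now apply Hf'.
- exists (fun s => RInt (fun v => v ^ S k * f' (s * v)) 0 1).
  split; [|now apply IH]. intros s _. apply is_derive_RInt_scaled.
  + intros x. now apply Hf.
  + intros x. exact (class_C_continuous _ _ _ x Hf' I).
Qed.

Lemma RInt_scal_l c f a b :
  ex_RInt f a b -> RInt (fun x : R => c * f x) a b = c * RInt f a b.
Proof. exact (RInt_scal (V := R_CompleteNormedModule) f a b c). Qed.

Lemma RInt_concat (f : R -> R) a b c :
  ex_RInt f a b -> ex_RInt f b c -> RInt f a c = RInt f a b + RInt f b c.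
Proof.
intros H1 H2. symmetry. exact (RInt_Chasles (V := R_CompleteNormedModule) f a b c H1 H2).
Qed.

(** Hadamard's lemma: the quotient [(f s - f 0) / s] extends smoothly through
    [0], because it equals the mean of [f'] over the segment from [0] to [s]. *)
Lemma Hadamard_quotient n f :
  class_C everywhere (S (S n)) f ->
  exists g, class_C everywhere n g /\ forall s, f s = f 0 + s * g s.
Proof.
intros [f' [Hf Hf']].
exists (fun s => RInt (fun v => v ^ 0 * f' (s * v)) 0 1).
split; [now apply class_C_RInt_scaled|]. intros s.
assert (H : is_RInt (fun v => s * f' (s * v)) 0 1 (f s - f 0)).
{ replace (f s - f 0) with (minus (f (s * 1)) (f (s * 0))) by
    (rewrite Rmult_1_r, Rmult_0_r; reflexivity).
  apply (is_RInt_derive (fun v => f (s * v))).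
  - intros v _. apply (is_derive_comp f (fun z => s * z)); [now apply Hf|].
    auto_derive; [easy | ring].
  - intros v _. apply (@continuous_mult _ R_AbsRing); [apply continuous_const|].
    apply (continuous_comp (fun v => s * v) f').
    + apply (is_derive_continuous _ _ s). auto_derive; [easy | ring].
    + exact (class_C_continuous _ _ _ _ Hf' I). }
apply (is_RInt_unique (V := R_CompleteNormedModule)) in H.
rewrite (RInt_ext _ (fun v => f' (s * v))) by (intros; simpl; ring).
rewrite RInt_scal_l in H; [lra|].
apply @ex_RInt_continuous. intros z _.
apply (continuous_comp (fun v => s * v) f').
- apply (is_derive_continuous _ _ s). auto_derive; [easy | ring].
- exact (class_C_continuous _ _ _ _ Hf' I).
Qed.

(** * Integration by parts against an oscillating factor *)

Lemma is_derive_phase (f : R -> R) (l t beta x : R) :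
  is_derive f x l -> is_derive (fun x => t * f x + beta) x (t * l).
Proof.
intros Hd. auto_derive; [now exists l|].
replace (Derive (fun x => f x) x) with l
  by (symmetry; exact (is_derive_unique _ _ _ Hd)). ring.
Qed.

Lemma continuous_cos_phase (f : R -> R) (t beta x : R) :
  continuous f x -> continuous (fun x => cos (t * f x + beta)) x.
Proof.
intros Hf. apply (continuous_comp (fun x => t * f x + beta) cos); [|apply continuous_cos].
apply @continuous_plus; [|apply continuous_const].
apply @continuous_mult; [apply continuous_const | exact Hf].
Qed.

(** Since [t * f' * cos (t * f + beta)] is the derivative of [sin (t * f + beta)],
    a factor [f'] in front of the oscillation gains a power of [t].  In the last
    integral [beta] is shifted so as to write the sine as a cosine again, which
    makes the step repeatable. *)
Lemma oscillating_by_parts (B B' f f' : R -> R) (a b t beta : R) :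
  a <= b ->
  (forall x, a <= x <= b -> is_derive B x (B' x) /\ continuous B' x) ->
  (forall x, a <= x <= b -> is_derive f x (f' x) /\ continuous f' x) ->
  t * RInt (fun x => B x * f' x * cos (t * f x + beta)) a b =
  B b * sin (t * f b + beta) - B a * sin (t * f a + beta)
  - RInt (fun x => B' x * cos (t * f x + (beta - PI / 2))) a b.
Proof.
intros Hab HB Hf.
assert (Hsin : forall x, sin (t * f x + beta) = cos (t * f x + (beta - PI / 2))).
{ intros x. replace (t * f x + (beta - PI / 2)) with (- (PI / 2 - (t * f x + beta))) by ring.
  now rewrite cos_neg, cos_shift. }
assert (H2 : ex_RInt (fun x => B' x * cos (t * f x + (beta - PI / 2))) a b).
{ apply @ex_RInt_continuous. rewrite Rmin_left, Rmax_right by lra. intros x Hx.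
  apply @continuous_mult; [now apply HB|].
  apply continuous_cos_phase, (is_derive_continuous _ _ (f' x)), Hf, Hx. }
assert (H3 : ex_RInt (fun x => B x * f' x * cos (t * f x + beta)) a b).
{ apply @ex_RInt_continuous. rewrite Rmin_left, Rmax_right by lra. intros x Hx.
  apply @continuous_mult.
  - apply @continuous_mult; [|now apply Hf].
    now apply (is_derive_continuous _ _ (B' x)), HB.
  - apply continuous_cos_phase, (is_derive_continuous _ _ (f' x)), Hf, Hx. }
assert (H1 : is_RInt (fun x => B' x * cos (t * f x + (beta - PI / 2))
                 + t * (B x * f' x * cos (t * f x + beta)))
               a b (B b * sin (t * f b + beta) - B a * sin (t * f a + beta))).
{ apply (is_RInt_derive (fun x => B x * sin (t * f x + beta)));
    rewrite Rmin_left, Rmax_right by lra; intros x Hx;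
    destruct (HB x Hx) as [Hd Hc], (Hf x Hx) as [Hd' Hc'].
  - rewrite <- Hsin.
    replace (_ + _) with (B' x * sin (t * f x + beta)
      + B x * (t * f' x * cos (t * f x + beta))) by ring.
    apply is_derive_Reals, (derivable_pt_lim_mult B (fun x => sin (t * f x + beta)));
      apply is_derive_Reals; [exact Hd|].
    apply (is_derive_comp sin (fun x => t * f x + beta) x (cos (t * f x + beta)) (t * f' x));
      [apply is_derive_sin|].
    now apply is_derive_phase.
  - pose proof (is_derive_continuous _ _ _ Hd). pose proof (is_derive_continuous _ _ _ Hd').
    apply @continuous_plus.
    + apply @continuous_mult; [exact Hc | now apply continuous_cos_phase].
    + apply @continuous_mult; [apply continuous_const|].
      apply @continuous_mult; [|now apply continuous_cos_phase].
      now apply @continuous_mult. }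
apply (is_RInt_unique (V := R_CompleteNormedModule)) in H1.
rewrite <- H1, <- RInt_scal_l by exact H3.
rewrite (RInt_plus (V := R_CompleteNormedModule)); [|exact H2|].
- change plus with Rplus. lra.
- apply (ex_RInt_scal (V := R_CompleteNormedModule)), H3.
Qed.

Lemma oscillating_by_parts_bound (B B' f f' : R -> R) (a b t beta : R) :
  a <= b -> 0 < t ->
  (forall x, a <= x <= b -> is_derive B x (B' x) /\ continuous B' x) ->
  (forall x, a <= x <= b -> is_derive f x (f' x) /\ continuous f' x) ->
  Rabs (RInt (fun x => B x * f' x * cos (t * f x + beta)) a b) <=
  (Rabs (B a) + Rabs (B b) + RInt (fun x => Rabs (B' x)) a b) / t.
Proof.
intros Hab Ht HB Hf.
pose proof (oscillating_by_parts B B' f f' a b t beta Hab HB Hf) as E.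
set (J := RInt (fun x => B x * f' x * _) a b) in *.
set (J' := RInt (fun x => B' x * _) a b) in *.
assert (Hlt : forall y z, Rabs z <= 1 -> Rabs (y * z) <= Rabs y).
{ intros y z Hz. rewrite Rabs_mult. rewrite <- (Rmult_1_r (Rabs y)) at 2.
  apply Rmult_le_compat_l; [apply Rabs_pos | exact Hz]. }
assert (HR : Rabs J' <= RInt (fun x => Rabs (B' x)) a b).
{ assert (Cc : forall x, a <= x <= b ->
    continuous (fun x => B' x * cos (t * f x + (beta - PI / 2))) x).
  { intros x Hx. apply @continuous_mult; [now apply HB|].
    apply continuous_cos_phase, (is_derive_continuous _ _ (f' x)), Hf, Hx. }
  eapply Rle_trans; [apply abs_RInt_le; [exact Hab|]|].
  - apply @ex_RInt_continuous. now rewrite Rmin_left, Rmax_right by lra.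
  - apply RInt_le; [exact Hab| | |].
    + apply @ex_RInt_continuous. rewrite Rmin_left, Rmax_right by lra. intros x Hx.
      apply (continuous_comp _ Rabs); [now apply Cc | apply continuous_Rabs].
    + apply @ex_RInt_continuous. rewrite Rmin_left, Rmax_right by lra. intros x Hx.
      apply (continuous_comp B' Rabs); [apply HB, Hx | apply continuous_Rabs].
    + intros x _. apply Hlt, Rabs_le, COS_bound. }
pose proof (Hlt (B a) (sin (t * f a + beta)) ltac:(apply Rabs_le, SIN_bound)).
pose proof (Hlt (B b) (sin (t * f b + beta)) ltac:(apply Rabs_le, SIN_bound)).
apply Rmult_le_reg_l with t; [exact Ht|].
replace (t * (_ / t)) with
  (Rabs (B a) + Rabs (B b) + RInt (fun x => Rabs (B' x)) a b) by (field; lra).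
rewrite <- (Rabs_pos_eq t) at 1 by lra. rewrite <- Rabs_mult, E.
unfold Rminus.
eapply Rle_trans; [apply Rabs_triang|]. rewrite Rabs_Ropp.
eapply Rle_trans; [apply Rplus_le_compat_r, Rabs_triang|]. rewrite Rabs_Ropp. lra.
Qed.

(** * The Fresnel integral *)

Definition fresnel (beta x : R) : R := RInt (fun u => cos (u ^ 2 + beta)) 0 x.

Lemma ex_RInt_fresnel beta a b : ex_RInt (fun u => cos (u ^ 2 + beta)) a b.
Proof.
apply @ex_RInt_continuous. intros u _.
apply (is_derive_continuous _ _ (- (2 * u * sin (u ^ 2 + beta)))).
auto_derive; [easy | simpl; ring].
Qed.

Lemma fresnel_derive beta x : is_derive (fresnel beta) x (cos (x ^ 2 + beta)).
Proof.
apply (is_derive_RInt (V := R_NormedModule) (fun u => cos (u ^ 2 + beta)) _ 0).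
- apply filter_forall. intros y. apply (RInt_correct (V := R_CompleteNormedModule)),
    ex_RInt_fresnel.
- apply (is_derive_continuous _ _ (- (2 * x * sin (x ^ 2 + beta)))).
  auto_derive; [easy | simpl; ring].
Qed.

Lemma fresnel_phase beta x :
  fresnel beta x = cos beta * fresnel 0 x - sin beta * fresnel (- (PI / 2)) x.
Proof.
unfold fresnel. rewrite <- !RInt_scal_l by apply ex_RInt_fresnel.
transitivity (RInt (V := R_CompleteNormedModule) (fun u =>
  minus (cos beta * cos (u ^ 2 + 0)) (sin beta * cos (u ^ 2 + - (PI / 2)))) 0 x).
- apply RInt_ext. intros u _. rewrite Rplus_0_r.
  replace (u ^ 2 + - (PI / 2)) with (- (PI / 2 - u ^ 2)) by ring.
  rewrite cos_neg, cos_shift, cos_plus. unfold minus, plus, opp; simpl. ring.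
- apply (RInt_minus (V := R_CompleteNormedModule));
    apply (ex_RInt_scal (V := R_CompleteNormedModule)), ex_RInt_fresnel.
Qed.

Lemma fresnel_tail beta x y :
  0 < x -> x <= y -> Rabs (fresnel beta y - fresnel beta x) <= / x.
Proof.
intros Hx Hxy.
replace (fresnel beta y - fresnel beta x) with
  (RInt (fun u => / (2 * u) * (2 * u) * cos (1 * u ^ 2 + beta)) x y).
2: { transitivity (RInt (fun u => cos (u ^ 2 + beta)) x y).
     - apply RInt_ext. rewrite Rmin_left by lra. intros u Hu.
       rewrite Rmult_1_l.
       change (/ (2 * u) * (2 * u) * cos (u ^ 2 + beta) = cos (u ^ 2 + beta) :> R).
       field. lra.
     - unfold fresnel. rewrite (RInt_concat _ 0 x y) by apply ex_RInt_fresnel. lra. }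
eapply Rle_trans.
- apply (oscillating_by_parts_bound (fun u => / (2 * u)) (fun u => - / (2 * u ^ 2))
    (fun u => u ^ 2) (fun u => 2 * u)); [exact Hxy | lra | |].
  + intros u Hu. split.
    * auto_derive; [lra|]. field. lra.
    * apply (is_derive_continuous _ _ (/ u ^ 3)). auto_derive; [|field; lra].
      apply Rgt_not_eq. simpl. apply Rmult_lt_0_compat; [lra|].
      rewrite Rmult_1_r. apply Rmult_lt_0_compat; lra.
  + intros u Hu. split.
    * auto_derive; [easy | ring].
    * apply (is_derive_continuous _ _ 2). auto_derive; [easy | ring].
- assert (H : is_RInt (fun u => / (2 * u ^ 2)) x y (/ (2 * x) - / (2 * y))).
  { replace (/ (2 * x) - / (2 * y)) with (minus (- / (2 * y)) (- / (2 * x)))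
      by (unfold minus, plus, opp; simpl; ring).
    apply (is_RInt_derive (fun u => - / (2 * u))); rewrite Rmin_left by lra;
      intros u Hu.
    - auto_derive; [lra | field; lra].
    - apply (is_derive_continuous _ _ (- / u ^ 3)). auto_derive; [|field; lra].
      apply Rgt_not_eq. simpl. apply Rmult_lt_0_compat; [lra|].
      rewrite Rmult_1_r. apply Rmult_lt_0_compat; lra. }
  apply (is_RInt_unique (V := R_CompleteNormedModule)) in H.
  rewrite (RInt_ext (fun u => Rabs (- / (2 * u ^ 2))) (fun u => / (2 * u ^ 2))), H.
  + rewrite !Rabs_pos_eq by (left; apply Rinv_0_lt_compat; lra).
    right. field. lra.
  + rewrite Rmin_left by lra. intros u Hu. rewrite Rabs_Ropp, Rabs_pos_eq; [easy|].
    left. apply Rinv_0_lt_compat. nra.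
Qed.

Lemma fresnel_bounded beta x : 0 <= x -> Rabs (fresnel beta x) <= 2.
Proof.
assert (H : forall y, 0 <= y <= 1 -> Rabs (fresnel beta y) <= 1).
{ intros y Hy. eapply Rle_trans.
  - apply abs_RInt_le_const with (M := 1); [lra | apply ex_RInt_fresnel|].
    intros u _. apply Rabs_le, COS_bound.
  - lra. }
intros Hx. destruct (Rle_dec x 1) as [H1|H1].
- specialize (H x (conj Hx H1)). lra.
- pose proof (H 1 ltac:(lra)). pose proof (fresnel_tail beta 1 x ltac:(lra) ltac:(lra)).
  replace (fresnel beta x) with ((fresnel beta x - fresnel beta 1) + fresnel beta 1) by ring.
  eapply Rle_trans; [apply Rabs_triang|]. lra.
Qed.

Lemma fresnel_substitution beta (g g' : R -> R) d :
  0 <= d -> g 0 = 0 ->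
  (forall s, 0 <= s <= d -> is_derive g s (g' s) /\ continuous g' s) ->
  RInt (fun s => g' s * cos (g s ^ 2 + beta)) 0 d = fresnel beta (g d).
Proof.
intros Hd H0 Hg. unfold fresnel.
generalize (RInt_comp (V := R_CompleteNormedModule)
  (fun u => cos (u ^ 2 + beta)) g g' 0 d).
rewrite H0, Rmin_left, Rmax_right by exact Hd. intros <-; [easy| |exact Hg].
intros s _. apply (is_derive_continuous _ _ (- (2 * g s * sin (g s ^ 2 + beta)))).
auto_derive; [easy | simpl; ring].
Qed.

Lemma fresnel_scaled beta x :
  x * RInt (fun s => cos (x ^ 2 * s ^ 2 + beta)) 0 1 = fresnel beta x.
Proof.
replace (fresnel beta x) with (fresnel beta (x * 1)) by (f_equal; ring).
rewrite <- (fresnel_substitution beta (fun s => x * s) (fun _ => x) 1); [|lra|ring|].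
- rewrite <- RInt_scal_l.
  + apply RInt_ext. intros s _. now rewrite Rpow_mult_distr.
  + apply @ex_RInt_continuous. intros s _.
    apply (is_derive_continuous _ _ (- (x ^ 2 * (2 * s) * sin (x ^ 2 * s ^ 2 + beta)))).
    auto_derive; [easy | simpl; ring].
- intros s _. split; [|apply continuous_const]. auto_derive; [easy | ring].
Qed.

(** The term that completes the square of the Fresnel integral to a constant in
    [fresnel_square]. *)
Definition fresnel_aux (beta x : R) : R :=
  RInt (fun s => cos (x ^ 2 * (1 + s ^ 2) + beta) / (1 + s ^ 2)) 0 1.

Lemma one_plus_sqr_pos s : 0 < 1 + s ^ 2.
Proof. pose proof (pow2_ge_0 s). lra. Qed.

Lemma continuous_fresnel_aux_integrand beta x s :
  continuous (fun s => cos (x ^ 2 * (1 + s ^ 2) + beta) / (1 + s ^ 2)) s.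
Proof.
pose proof (one_plus_sqr_pos s).
apply @continuous_mult.
- apply (is_derive_continuous _ _ (- (x ^ 2 * (2 * s) * sin (x ^ 2 * (1 + s ^ 2) + beta)))).
  auto_derive; [easy | simpl; ring].
- apply (is_derive_continuous _ _ (- (2 * s) / (1 + s ^ 2) ^ 2)).
  auto_derive; simpl in *; [lra | field; lra].
Qed.

Lemma fresnel_aux_derive beta x :
  is_derive (fresnel_aux beta) x
    (RInt (fun s => - 2 * x * sin (x ^ 2 * (1 + s ^ 2) + beta)) 0 1).
Proof.
apply (is_derive_RInt_parameter
  (fun x s => cos (x ^ 2 * (1 + s ^ 2) + beta) / (1 + s ^ 2))
  (fun x s => - 2 * x * sin (x ^ 2 * (1 + s ^ 2) + beta))).
- intros u v. pose proof (one_plus_sqr_pos v).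
  auto_derive; simpl in *; [easy | field; lra].
- intros u v. apply continuous_fresnel_aux_integrand.
- intros u v. apply continuity_2d_pt_mult.
  + apply continuity_2d_pt_mult; [apply continuity_2d_pt_const|apply continuity_2d_pt_id1].
  + apply (continuity_1d_2d_pt_comp sin).
    { apply continuity_pt_filterlim, continuous_sin. }
    assert (Hsq : forall y : R, continuity_pt (fun z : R => z ^ 2) y).
    { intros y. apply continuity_pt_filterlim, (is_derive_continuous (fun z : R => z ^ 2) _ (2 * y)).
      auto_derive; [easy | ring]. }
    apply continuity_2d_pt_plus; [|apply continuity_2d_pt_const].
    apply continuity_2d_pt_mult; [|apply continuity_2d_pt_plus].
    * apply (continuity_1d_2d_pt_comp (fun z => z ^ 2)); [apply Hsq | apply continuity_2d_pt_id1].
    * apply continuity_2d_pt_const.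
    * apply (continuity_1d_2d_pt_comp (fun z => z ^ 2)); [apply Hsq | apply continuity_2d_pt_id2].
Qed.

Lemma fresnel_aux_0 beta : fresnel_aux beta 0 = PI / 4 * cos beta.
Proof.
unfold fresnel_aux.
rewrite (RInt_ext _ (fun s => cos beta * (/ (1 + s ^ 2)))).
2: { intros s _. rewrite pow_i, Rmult_0_l, Rplus_0_l by lia. reflexivity. }
assert (H : is_RInt (fun s => / (1 + s ^ 2)) 0 1 (PI / 4)).
{ replace (PI / 4) with (minus (atan 1) (atan 0)).
  2: { rewrite atan_1, atan_0. unfold minus, plus, opp; simpl. ring. }
  apply (is_RInt_derive atan).
  - intros s _. replace (s ^ 2) with (Rsqr s) by (unfold Rsqr; ring). apply is_derive_atan.
  - intros s _. pose proof (one_plus_sqr_pos s).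
    apply (is_derive_continuous _ _ (- (2 * s) / (1 + s ^ 2) ^ 2)).
    auto_derive; simpl in *; [lra | field; lra]. }
rewrite RInt_scal_l by (eexists; exact H).
rewrite (is_RInt_unique (V := R_CompleteNormedModule) _ _ _ _ H). ring.
Qed.

(** With [E x] the integral of [exp (i u^2)] over the segment from [0] to [x],
    this is the rotation by [beta] of the identity
    [E x ^ 2 + i int_0^1 exp (i x^2 (1 + s^2)) / (1 + s^2) ds = i PI / 4]:
    the two summands have opposite derivatives in [x], and at [x = 0] only an
    arctangent is left. *)
Lemma fresnel_square beta x :
  cos beta * (fresnel 0 x ^ 2 - fresnel (- (PI / 2)) x ^ 2)
    - sin beta * (2 * fresnel 0 x * fresnel (- (PI / 2)) x) =
  fresnel_aux (beta - PI / 2) x - PI / 4 * sin beta.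
Proof.
set (F := fun x => cos beta * (fresnel 0 x ^ 2 - fresnel (- (PI / 2)) x ^ 2)
    - sin beta * (2 * fresnel 0 x * fresnel (- (PI / 2)) x)
    - fresnel_aux (beta - PI / 2) x).
assert (HF : forall y, is_derive F y 0).
{ intros y. pose proof (fresnel_derive 0 y) as H0.
  pose proof (fresnel_derive (- (PI / 2)) y) as H1.
  pose proof (fresnel_aux_derive (beta - PI / 2) y) as H2.
  unfold F. auto_derive.
  - repeat split; try (eexists; exact H0); try (eexists; exact H1). eexists; exact H2.
  - replace (Derive (fun x => fresnel 0 x) y) with (cos (y ^ 2 + 0))
      by (symmetry; exact (is_derive_unique _ _ _ H0)).
    replace (Derive (fun x => fresnel (- (PI / 2)) x) y) with (cos (y ^ 2 + - (PI / 2)))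
      by (symmetry; exact (is_derive_unique _ _ _ H1)).
    replace (Derive (fun x => fresnel_aux (beta - PI / 2) x) y)
      with (2 * fresnel (y ^ 2 + beta) y).
    + rewrite (fresnel_phase (y ^ 2 + beta)), Rplus_0_r.
      replace (y ^ 2 + - (PI / 2)) with (- (PI / 2 - y ^ 2)) by ring.
      rewrite cos_neg, cos_shift, cos_plus, sin_plus. ring.
    + symmetry. etransitivity; [exact (is_derive_unique _ _ _ H2)|].
      rewrite <- fresnel_scaled, <- Rmult_assoc, <- RInt_scal_l.
      * apply RInt_ext. intros s _.
        replace (y ^ 2 * (1 + s ^ 2) + (beta - PI / 2))
          with (- (PI / 2 - (y ^ 2 * s ^ 2 + (y ^ 2 + beta)))) by ring.
        rewrite sin_neg, sin_shift.
        change (- 2 * y * - cos (y ^ 2 * s ^ 2 + (y ^ 2 + beta)) =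
          2 * y * cos (y ^ 2 * s ^ 2 + (y ^ 2 + beta)) :> R). ring.
      * apply @ex_RInt_continuous. intros s _.
        apply (is_derive_continuous _ _
          (- (y ^ 2 * (2 * s) * sin (y ^ 2 * s ^ 2 + (y ^ 2 + beta))))).
        auto_derive; [easy | simpl; ring]. }
assert (HE : F x = F 0).
{ destruct (MVT_gen F 0 x (fun _ => 0)) as [c [_ Hc]].
  - intros y _. apply HF.
  - intros y _. apply continuity_pt_filterlim, (is_derive_continuous _ _ _ (HF y)).
  - lra. }
assert (H00 : forall b, fresnel b 0 = 0)
  by (intros b; exact (RInt_point (V := R_CompleteNormedModule) 0 _)).
unfold F in HE. rewrite !H00, fresnel_aux_0 in HE.
assert (HS : cos (beta - PI / 2) = sin beta).
{ replace (beta - PI / 2) with (- (PI / 2 - beta)) by ring.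
  now rewrite cos_neg, cos_shift. }
rewrite HS in HE. lra.
Qed.

Lemma fresnel_aux_decay beta x : 1 <= x -> Rabs (fresnel_aux beta x) <= 4 / x.
Proof.
intros Hx. unfold fresnel_aux.
set (gam := x ^ 2 + beta).
assert (Hx2 : 0 < x ^ 2) by (apply pow_lt; lra).
(* the amplitude 1 / (1 + s^2) is split into its value at the stationary point
   and a multiple of the derivative of s^2 *)
assert (Hc1 : forall s, continuous (fun s => cos (x ^ 2 * s ^ 2 + gam)) s).
{ intros s. apply (is_derive_continuous _ _ (- (x ^ 2 * (2 * s) * sin (x ^ 2 * s ^ 2 + gam)))).
  auto_derive; [easy | simpl; ring]. }
assert (HdB : forall s, is_derive (fun s => - s / (2 * (1 + s ^ 2))) s
  (- (1 - s ^ 2) / (2 * (1 + s ^ 2) ^ 2))).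
{ intros s. pose proof (one_plus_sqr_pos s). auto_derive; simpl in *; [lra|field; lra]. }
assert (HcB' : forall s, continuous (fun s => - (1 - s ^ 2) / (2 * (1 + s ^ 2) ^ 2)) s).
{ intros s. pose proof (one_plus_sqr_pos s).
  apply (@ex_derive_continuous R_AbsRing R_NormedModule).
  auto_derive. apply Rgt_not_eq. simpl in *. nra. }
set (B := fun s => - s / (2 * (1 + s ^ 2))) in *.
assert (Hc2 : forall s, continuous (fun s => B s * (2 * s) * cos (x ^ 2 * s ^ 2 + gam)) s).
{ intros s. apply @continuous_mult; [|apply Hc1].
  apply @continuous_mult; [exact (is_derive_continuous _ _ _ (HdB s))|].
  apply @continuous_mult; [apply continuous_const | apply continuous_id]. }
assert (E : RInt (fun s => cos (x ^ 2 * (1 + s ^ 2) + beta) / (1 + s ^ 2)) 0 1 =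
  RInt (fun s => cos (x ^ 2 * s ^ 2 + gam)) 0 1 +
  RInt (fun s => B s * (2 * s) * cos (x ^ 2 * s ^ 2 + gam)) 0 1).
{ rewrite <- (RInt_plus (V := R_CompleteNormedModule)) by
    (apply @ex_RInt_continuous; intros; auto).
  apply RInt_ext. intros s _. unfold gam, B.
  replace (x ^ 2 * (1 + s ^ 2) + beta) with (x ^ 2 * s ^ 2 + (x ^ 2 + beta)) by ring.
  set (c := cos _). pose proof (one_plus_sqr_pos s).
  change (c / (1 + s ^ 2) = c + - s / (2 * (1 + s ^ 2)) * (2 * s) * c :> R).
  field. lra. }
rewrite E.
assert (H1 : Rabs (RInt (fun s => cos (x ^ 2 * s ^ 2 + gam)) 0 1) <= 2 / x).
{ apply Rmult_le_reg_l with x; [lra|]. replace (x * (2 / x)) with 2 by (field; lra).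
  rewrite <- (Rabs_pos_eq x) at 1 by lra.
  rewrite <- Rabs_mult, fresnel_scaled. apply fresnel_bounded. lra. }
assert (H2 : Rabs (RInt (fun s => B s * (2 * s) * cos (x ^ 2 * s ^ 2 + gam)) 0 1) <= 2 / x).
{ eapply Rle_trans.
  - apply (oscillating_by_parts_bound B (fun s => - (1 - s ^ 2) / (2 * (1 + s ^ 2) ^ 2))
      (fun s => s ^ 2) (fun s => 2 * s) 0 1 (x ^ 2) gam); [lra|exact Hx2| |].
    + intros s _. split; [apply HdB | apply HcB'].
    + intros s _. split; [auto_derive; [easy|ring]|].
      apply (is_derive_continuous _ _ 2). auto_derive; [easy | ring].
  - assert (HI : RInt (fun s => Rabs (- (1 - s ^ 2) / (2 * (1 + s ^ 2) ^ 2))) 0 1 <= 1).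
    { eapply Rle_trans; [apply Rle_abs|]. replace 1 with ((1 - 0) * 1) at 2 by ring.
      apply abs_RInt_le_const; [lra| |].
      - apply @ex_RInt_continuous. intros s _.
        apply (continuous_comp (fun s => - (1 - s ^ 2) / (2 * (1 + s ^ 2) ^ 2)) Rabs);
          [apply HcB' | apply continuous_Rabs].
      - intros s Hs. rewrite Rabs_Rabsolu. pose proof (pow2_ge_0 s).
        assert (s ^ 2 <= 1) by (simpl; nra).
        set (q := s ^ 2) in *.
        assert (0 < 2 * (1 + q) ^ 2) by (simpl; nra).
        unfold Rdiv. rewrite Rabs_mult, Rabs_Ropp, (Rabs_pos_eq (1 - q)) by lra.
        rewrite Rabs_pos_eq by (left; now apply Rinv_0_lt_compat).
        apply Rmult_le_reg_r with (2 * (1 + q) ^ 2); [lra|].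
        rewrite Rmult_assoc, Rinv_l by lra. simpl. nra. }
    assert (HB0 : Rabs (B 0) = 0).
    { unfold B, Rdiv. rewrite Ropp_0, Rmult_0_l. apply Rabs_R0. }
    assert (HB1 : Rabs (B 1) = / 4).
    { unfold B. replace (- (1) / (2 * (1 + 1 ^ 2))) with (- / 4) by field.
      rewrite Rabs_Ropp. apply Rabs_pos_eq. lra. }
    rewrite HB0, HB1. apply Rle_trans with (2 / x ^ 2).
    + apply Rmult_le_compat_r; [left; now apply Rinv_0_lt_compat | lra].
    + apply Rmult_le_compat_l; [lra|]. apply Rinv_le_contravar; [lra|]. simpl. nra. }
eapply Rle_trans; [apply Rabs_triang|]. lra.
Qed.

(** This lower bound selects the square root: the tail beyond [5 / 4] is at most
    [4 / 5], while [cos v >= 1 - v^2 / 2] makes the integral up to [5 / 4]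
    larger than that. *)
Lemma fresnel_cos_pos x : 5 / 4 <= x -> / 10 <= fresnel 0 x.
Proof.
intros Hx.
pose proof (fresnel_tail 0 (5 / 4) x ltac:(lra) Hx) as Ht.
apply Rabs_le_between in Ht.
assert (H : is_RInt (fun u => 1 - u ^ 4 / 2) 0 (5 / 4)
  (minus (5 / 4 - (5 / 4) ^ 5 / 10) (0 - 0 ^ 5 / 10))).
{ apply (is_RInt_derive (fun u => u - u ^ 5 / 10)).
  - intros u _. auto_derive; [easy | simpl; field].
  - intros u _. apply (is_derive_continuous _ _ (- (2 * u ^ 3))).
    auto_derive; [easy | simpl; field]. }
assert (Hle : RInt (fun u => 1 - u ^ 4 / 2) 0 (5 / 4) <= fresnel 0 (5 / 4)).
{ apply RInt_le; [lra|now eexists; exact H|apply ex_RInt_fresnel|].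
  intros u Hu. rewrite Rplus_0_r.
  replace (u ^ 4) with ((u ^ 2) ^ 2) by ring. set (v := u ^ 2).
  replace v with (2 * (v / 2)) at 2 by field. rewrite cos_2a_sin.
  assert (Hs : sin (v / 2) ^ 2 <= (v / 2) ^ 2).
  { assert (Hv : 0 <= v / 2) by (pose proof (pow2_ge_0 u); unfold v; lra).
    assert (Ha : Rabs (sin (v / 2)) <= Rabs (v / 2)).
    { rewrite (Rabs_pos_eq (v / 2)) by exact Hv. apply Rabs_le.
      destruct (Req_dec (v / 2) 0) as [->|Hnz]; [rewrite sin_0; lra|].
      pose proof (sin_lt_x (v / 2) ltac:(lra)).
      assert (Hv1 : v / 2 < 1) by (unfold v; simpl; nra).
      pose proof (sin_gt_0 (v / 2) ltac:(lra) ltac:(pose proof PI2_3_2; lra)). lra. }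
    apply pow_maj_Rabs with (n := 2%nat) in Ha. rewrite <- (pow2_abs (v / 2)). exact Ha. }
  nra. }
apply (is_RInt_unique (V := R_CompleteNormedModule)) in H. rewrite H in Hle.
unfold minus, plus, opp in Hle; simpl in Hle. lra.
Qed.


(** The square of the Fresnel integral is known up to [O (1 / x)] on
    [20 <= x], where the error [4 / x] is too small to change the sign of its
    imaginary part; [fresnel_cos_pos] then excludes the opposite root.  Smaller
    [x] are compared with [20] through the tail. *)
Lemma fresnel_components_asymptotic (c0 : R) :
  0 < c0 -> c0 ^ 2 = PI / 8 -> forall x, 0 < x ->
  Rabs (fresnel 0 x - c0) <= 900 / x /\
  Rabs (fresnel (- (PI / 2)) x - c0) <= 900 / x.
Proof.
intros Hc0 Hsq.
assert (Hfar : forall x, 20 <= x ->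
  Rabs (fresnel 0 x - c0) <= 820 / x /\ Rabs (fresnel (- (PI / 2)) x - c0) <= 860 / x).
{ intros x Hx.
  assert (Hinv : 0 < / x) by (apply Rinv_0_lt_compat; lra).
  assert (Hinv' : / x <= / 20) by (apply Rinv_le_contravar; lra).
  pose proof (fresnel_square 0 x) as E0. pose proof (fresnel_square (PI / 2) x) as E1.
  rewrite cos_0, sin_0 in E0. rewrite cos_PI2, sin_PI2 in E1.
  pose proof (fresnel_aux_decay (0 - PI / 2) x ltac:(lra)) as B0.
  pose proof (fresnel_aux_decay (PI / 2 - PI / 2) x ltac:(lra)) as B1.
  apply Rabs_le_between in B0. apply Rabs_le_between in B1.
  pose proof (fresnel_cos_pos x ltac:(lra)) as HC.
  pose proof (fresnel_bounded 0 x ltac:(lra)) as HC2. apply Rabs_le_between in HC2.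
  set (c := fresnel 0 x) in *. set (s := fresnel (- (PI / 2)) x) in *.
  set (a0 := fresnel_aux (0 - PI / 2) x) in *.
  set (a1 := fresnel_aux (PI / 2 - PI / 2) x) in *.
  unfold Rdiv in B0, B1 |- *. set (ix := / x) in *.
  pose proof PI2_3_2.
  assert (Hs : 0 < s).
  { apply Rmult_lt_reg_l with c; [lra|]. lra. }
  assert (H1 : Rabs (c - s) <= 40 * ix).
  { apply Rmult_le_reg_r with (c + s); [lra|].
    rewrite <- (Rabs_pos_eq (c + s)) at 1 by lra. rewrite <- Rabs_mult.
    replace ((c - s) * (c + s)) with a0 by lra. apply Rabs_le. nra. }
  apply Rabs_le_between in H1.
  assert (H2 : Rabs (c - c0) <= 820 * ix).
  { apply Rmult_le_reg_r with (c + c0); [lra|].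
    rewrite <- (Rabs_pos_eq (c + c0)) at 1 by lra. rewrite <- Rabs_mult.
    replace ((c - c0) * (c + c0)) with (c * (c - s) + (c * s - PI / 8)) by
      (rewrite <- Hsq; ring).
    apply Rle_trans with (82 * ix); [|nra].
    apply Rabs_le. split; nra. }
  split; [exact H2|]. apply Rabs_le_between in H2. apply Rabs_le. lra. }
intros x Hx. destruct (Rle_dec 20 x) as [H|H].
- destruct (Hfar x H) as [H1 H2].
  assert (0 < / x) by (apply Rinv_0_lt_compat; lra).
  unfold Rdiv in *. lra.
- destruct (Hfar 20 ltac:(lra)) as [H1 H2].
  pose proof (fresnel_tail 0 x 20 Hx ltac:(lra)) as T1.
  pose proof (fresnel_tail (- (PI / 2)) x 20 Hx ltac:(lra)) as T2.
  assert (Hinv : / 20 <= / x) by (apply Rinv_le_contravar; lra).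
  unfold Rdiv in *. apply Rabs_le_between in H1, H2, T1, T2.
  split; apply Rabs_le; lra.
Qed.

Lemma fresnel_asymptotic beta x :
  0 < x -> Rabs (fresnel beta x - sqrt PI / 2 * cos (beta + PI / 4)) <= 1800 / x.
Proof.
intros Hx. set (c0 := sqrt PI / 2 * (1 / sqrt 2)).
assert (H2 : 0 < sqrt 2) by (apply sqrt_lt_R0; lra).
assert (HP : 0 < sqrt PI) by apply sqrt_lt_R0, PI_RGT_0.
destruct (fresnel_components_asymptotic c0) with (x := x) as [HC HS]; [| |exact Hx|].
- unfold c0. apply Rmult_lt_0_compat; [lra|]. apply Rdiv_lt_0_compat; lra.
- unfold c0. replace ((sqrt PI / 2 * (1 / sqrt 2)) ^ 2)
    with (sqrt PI ^ 2 / (4 * sqrt 2 ^ 2)) by (field; lra).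
  rewrite !pow2_sqrt; [field | lra | left; apply PI_RGT_0].
- rewrite fresnel_phase, cos_plus, cos_PI4, sin_PI4.
  replace (_ - _) with (cos beta * (fresnel 0 x - c0)
    + - sin beta * (fresnel (- (PI / 2)) x - c0)).
  2: { unfold c0. ring. }
  eapply Rle_trans; [apply Rabs_triang|]. rewrite !Rabs_mult, Rabs_Ropp.
  replace (1800 / x) with (1 * (900 / x) + 1 * (900 / x)) by (field; lra).
  apply Rplus_le_compat; (apply Rmult_le_compat; [apply Rabs_pos|apply Rabs_pos| |assumption]);
    apply Rabs_le; [apply COS_bound | apply SIN_bound].
Qed.

(** * Contribution of one side of a stationary point *)

(** The remainder [r] of the second-order Taylor polynomial, divided by [s ^ 3],
    is of class C^2: each of the three Hadamard quotients costs two
    derivatives out of eight. *)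
Lemma nondegenerate_factorization (h h' : R -> R) (m : R) :
  class_C everywhere 8 h ->
  (forall s, is_derive h s (h' s)) -> h' 0 = 0 -> is_derive h' 0 m ->
  exists r r' : R -> R,
    (forall s, is_derive r s (r' s)) /\ class_C everywhere 1 r' /\
    (forall s, h s = h 0 + s ^ 2 * (m / 2 + s * r s)) /\
    (forall s, h' s = s * (m + 3 * s * r s + s ^ 2 * r' s)).
Proof.
intros Hh Hd H0 Hm.
destruct (Hadamard_quotient _ _ Hh) as [g1 [Hg1 E1]].
destruct (Hadamard_quotient _ _ Hg1) as [g2 [Hg2 E2]].
destruct (Hadamard_quotient _ _ Hg2) as [r [Hr E3]].
assert (E : forall s, h s = h 0 + g1 0 * s + g2 0 * s ^ 2 + s ^ 3 * r s).
{ intros s. rewrite E1, E2, E3. ring. }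
destruct Hr as [r' [Hr Hr']].
assert (Hr0 : forall s, is_derive r s (r' s)) by (intros s; now apply Hr).
assert (E' : forall s, h' s = g1 0 + 2 * g2 0 * s + (3 * s ^ 2 * r s + s ^ 3 * r' s)).
{ intros s. rewrite <- (is_derive_unique _ _ _ (Hd s)). apply is_derive_unique.
  apply (is_derive_ext (fun s => h 0 + g1 0 * s + g2 0 * s ^ 2 + s ^ 3 * r s)).
  - intros z. symmetry. apply E.
  - auto_derive; [now exists (r' s)|].
    replace (Derive (fun x => r x) s) with (r' s)
      by (symmetry; exact (is_derive_unique _ _ _ (Hr0 s))). simpl. ring. }
assert (Ha : g1 0 = 0).
{ specialize (E' 0). rewrite H0 in E'. simpl in E'. lra. }
assert (Hb : 2 * g2 0 = m).
{ pose proof Hr' as [r'' [Hr'' _]]. specialize (Hr'' 0 I).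
  rewrite <- (is_derive_unique _ _ _ Hm). symmetry. apply is_derive_unique.
  apply (is_derive_ext (fun s => g1 0 + 2 * g2 0 * s + (3 * s ^ 2 * r s + s ^ 3 * r' s))).
  - intros z. symmetry. apply E'.
  - auto_derive; [|simpl; ring].
    split; [now exists (r' 0)|]. split; [now exists (r'' 0) | easy]. }
exists r, r'. split; [exact Hr0|]. split; [exact Hr'|]. split.
- intros s. rewrite E, Ha. rewrite <- Hb. field.
- intros s. rewrite E', Ha, <- Hb. ring.
Qed.

Lemma positive_near (f : R -> R) :
  continuous f 0 -> 0 < f 0 -> exists d, 0 < d /\ forall s, Rabs s < d -> 0 < f s.
Proof.
intros Hc Hp.
destruct (Hc (fun y => 0 < y)) as [d Hd].
- exists (mkposreal _ Hp). intros y Hy. apply Rabs_lt_between in Hy.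
  unfold minus, plus, opp in Hy; simpl in Hy. lra.
- exists d. split; [apply cond_pos|]. intros s Hs. apply Hd.
  unfold ball; simpl; unfold AbsRing_ball, abs, minus, plus, opp; simpl.
  now rewrite Ropp_0, Rplus_0_r.
Qed.

(** Morse coordinate [u = s * sqrt (w s)], in which [h s = h 0 + u ^ 2].  The
    constant amplitude is the sum of a multiple of [u'], whose integral is exactly
    a Fresnel integral, and of [B * h'], which integration by parts makes
    [O (1 / t)]; [B] has no pole at the simple zero [0] of [h'] because that
    multiple of [u'] takes the value [1] there. *)
Lemma half_stationary_phase (h h' : R -> R) (m : R) :
  class_C everywhere 8 h -> (forall s, is_derive h s (h' s)) ->
  h' 0 = 0 -> is_derive h' 0 m -> 0 < m ->
  exists delta, 0 < delta /\
    (forall s, s <> 0 -> Rabs s < delta -> h' s <> 0) /\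
    forall d, 0 < d < delta -> exists C, forall t beta, 0 < t ->
      Rabs (RInt (fun s => cos (t * h s + beta)) 0 d
            - sqrt (PI / (2 * m * t)) * cos (t * h 0 + beta + PI / 4)) <= C / t.
Proof.
intros Hh Hd H0 Hm Hpos.
destruct (nondegenerate_factorization h h' m Hh Hd H0 Hm) as [r [r' [Hr [Hr' [Eh Eh']]]]].
set (w := fun s => m / 2 + s * r s) in *.
set (w' := fun s => r s + s * r' s).
set (v := fun s => m + 3 * s * r s + s ^ 2 * r' s) in *.
assert (Cr : class_C everywhere 1 r).
{ exists r'. split; [intros s _; apply Hr | now apply class_C_pred]. }
assert (Cw : class_C everywhere 1 w).
{ apply class_C_plus; [apply class_C_const|].
  apply class_C_mult; [apply class_C_id | exact Cr]. }
assert (Cw' : class_C everywhere 1 w').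
{ apply class_C_plus; [exact Cr|]. apply class_C_mult; [apply class_C_id | exact Hr']. }
assert (Cv : class_C everywhere 1 v).
{ apply (class_C_ext _ _ (fun s => 2 * w s + s * w' s)).
  - intros s. unfold w, w', v. field.
  - apply class_C_plus; [now apply class_C_scal|].
    apply class_C_mult; [apply class_C_id | exact Cw']. }
assert (Ev : forall s, v s = 2 * w s + s * w' s) by (intros s; unfold w, w', v; field).
assert (Hw0 : w 0 = m / 2) by (unfold w; ring).
assert (Hv0 : v 0 = m) by (unfold v; ring).
destruct (positive_near w) as [d1 [Hd1 Pw]];
  [exact (class_C_continuous _ _ _ 0 Cw I) | lra|].
destruct (positive_near v) as [d2 [Hd2 Pv]];
  [exact (class_C_continuous _ _ _ 0 Cv I) | lra|].
set (delta := Rmin d1 d2).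
assert (Hdelta : forall s, Rabs s < delta -> 0 < w s /\ 0 < v s).
{ intros s Hs. split; [apply Pw | apply Pv];
    (eapply Rlt_le_trans; [exact Hs|]); [apply Rmin_l | apply Rmin_r]. }
exists delta. split; [now apply Rmin_pos|]. split.
{ intros s Hs Hsd. rewrite Eh'. fold (v s). destruct (Hdelta s Hsd) as [_ Hv].
  apply Rmult_integral_contrapositive_currified; [exact Hs | lra]. }
intros d Hdd.
set (D := fun s => Rabs s < delta).
set (w0 := w 0). assert (Pw0 : 0 < sqrt w0) by (apply sqrt_lt_R0; unfold w0; lra).
assert (Psw : forall s, D s -> 0 < sqrt (w s)) by (intros s Hs; apply sqrt_lt_R0, Hdelta, Hs).
assert (Ww : forall f, class_C everywhere 1 f -> class_C D 1 f)
  by (intros f; now apply class_C_restrict).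
assert (Csw : class_C D 1 (fun s => sqrt (w s))).
{ apply class_C_sqrt; [intros s Hs; apply Hdelta, Hs | now apply Ww]. }
set (u := fun s => s * sqrt (w s)).
set (u' := fun s => sqrt (w s) + s * (w' s / (2 * sqrt (w s)))).
(* (1 - u' / sqrt w0) / h', with the common factor s cancelled by means of
   sqrt w - sqrt w0 = s * r / (sqrt w + sqrt w0) *)
set (B := fun s => -1 * (r s / (sqrt (w s) + sqrt w0) + w' s / (2 * sqrt (w s)))
                   / (sqrt w0 * v s)).
assert (Cq : class_C D 1 (fun s => w' s / (2 * sqrt (w s)))).
{ apply class_C_div; [|now apply Ww|now apply class_C_scal].
  intros s Hs. specialize (Psw s Hs). lra. }
assert (CB : class_C D 1 B).
{ apply class_C_div.
  - intros s Hs. apply Rgt_not_eq, Rmult_lt_0_compat; [exact Pw0 | apply Hdelta, Hs].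
  - apply class_C_scal, class_C_plus; [|exact Cq].
    apply class_C_div; [|now apply Ww|].
    + intros s Hs. specialize (Psw s Hs). lra.
    + apply class_C_plus; [exact Csw | apply class_C_const].
  - apply class_C_scal. now apply Ww. }
assert (Hu : forall s, D s -> is_derive u s (u' s)).
{ intros s Hs. unfold u, u'. specialize (Psw s Hs). pose proof (Hdelta s Hs).
  assert (Hdw : is_derive w s (w' s)).
  { unfold w, w'. auto_derive; [now exists (r' s)|].
    replace (Derive (fun x => r x) s) with (r' s)
      by (symmetry; exact (is_derive_unique _ _ _ (Hr s))). ring. }
  auto_derive; [split; [now exists (w' s) | easy]|].
  replace (Derive (fun x => w x) s) with (w' s)
      by (symmetry; exact (is_derive_unique _ _ _ Hdw)). field. lra. }
assert (Cu' : forall s, D s -> continuous u' s).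
{ intros s Hs. apply @continuous_plus; [exact (class_C_continuous _ _ _ s Csw Hs)|].
  apply @continuous_mult; [apply continuous_id | exact (class_C_continuous _ _ _ s Cq Hs)]. }
assert (HD : forall s, 0 <= s <= d -> D s).
{ intros s Hs. unfold D. rewrite Rabs_pos_eq; lra. }
assert (Hud : 0 < u d).
{ unfold u. apply Rmult_lt_0_compat; [lra|]. apply Psw, HD. lra. }
assert (Hh' : forall s, continuous h' s).
{ intros s. apply (continuous_ext (fun s => s * v s)); [intros x; symmetry; apply Eh'|].
  apply @continuous_mult; [apply continuous_id | exact (class_C_continuous _ _ _ s Cv I)]. }
assert (Hu0 : u 0 = 0) by (unfold u; ring).
assert (Ehu : forall s, D s -> h s = h 0 + u s ^ 2).
{ intros s Hs. rewrite Eh. fold (w s). unfold u. rewrite Rpow_mult_distr.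
  rewrite pow2_sqrt; [easy|]. left. apply Hdelta, Hs. }
assert (E1 : forall s, D s -> 1 = / sqrt w0 * u' s + B s * h' s).
{ intros s Hs. rewrite Eh'. fold (v s). unfold B, u'. specialize (Psw s Hs).
  destruct (Hdelta s Hs) as [Pws Pvs].
  assert (Ew : s * r s = (sqrt (w s) - sqrt w0) * (sqrt (w s) + sqrt w0)).
  { transitivity (sqrt (w s) ^ 2 - sqrt w0 ^ 2); [|ring].
    rewrite !pow2_sqrt by (unfold w0; lra). unfold w0, w. ring. }
  apply Rmult_eq_reg_l with (sqrt w0); [|lra].
  transitivity (sqrt (w s) - s * r s / (sqrt (w s) + sqrt w0)); [rewrite Ew|]; field; lra. }
destruct CB as [B' [HB HB']].
exists (1800 / (sqrt w0 * u d) + (Rabs (B 0) + Rabs (B d) + RInt (fun x => Rabs (B' x)) 0 d)).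
intros t beta Ht.
assert (Pt : 0 < sqrt t) by now apply sqrt_lt_R0.
set (gam := t * h 0 + beta).
assert (Ccos : forall s, continuous (fun s => cos (t * h s + beta)) s).
{ intros s. exact (continuous_cos_phase _ _ _ _ (is_derive_continuous _ _ _ (Hd s))). }
assert (ICu : ex_RInt (fun s => sqrt t * u' s * cos ((sqrt t * u s) ^ 2 + gam)) 0 d).
{ apply @ex_RInt_continuous. rewrite Rmin_left, Rmax_right by lra. intros s Hs.
  apply @continuous_mult.
  - apply @continuous_mult; [apply continuous_const | apply Cu', HD, Hs].
  - apply (continuous_comp (fun s => u s) (fun y => cos ((sqrt t * y) ^ 2 + gam))).
    + exact (is_derive_continuous _ _ _ (Hu s (HD s Hs))).
    + apply (@ex_derive_continuous R_AbsRing R_NormedModule). auto_derive. easy. }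
assert (EI : RInt (fun s => cos (t * h s + beta)) 0 d =
  / (sqrt w0 * sqrt t) * fresnel gam (sqrt t * u d)
  + RInt (fun s => B s * h' s * cos (t * h s + beta)) 0 d).
{ rewrite <- (fresnel_substitution gam (fun s => sqrt t * u s) (fun s => sqrt t * u' s)).
  - rewrite <- RInt_scal_l.
    + rewrite <- (RInt_plus (V := R_CompleteNormedModule)).
      * apply RInt_ext. rewrite Rmin_left, Rmax_right by lra. intros s Hs.
        assert (Ds : D s) by (apply HD; lra).
        assert (Ec : cos ((sqrt t * u s) ^ 2 + gam) = cos (t * h s + beta)).
        { f_equal. rewrite Rpow_mult_distr, pow2_sqrt, (Ehu s Ds) by lra. unfold gam. ring. }
        change plus with Rplus. rewrite Ec.
        rewrite <- (Rmult_1_l (cos _)) at 1. rewrite (E1 s Ds).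
        set (c := cos _).
        change ((/ sqrt w0 * u' s + B s * h' s) * c =
          / (sqrt w0 * sqrt t) * (sqrt t * u' s * c) + B s * h' s * c :> R).
        field. lra.
      * apply (ex_RInt_scal (V := R_CompleteNormedModule)), ICu.
      * apply @ex_RInt_continuous. rewrite Rmin_left, Rmax_right by lra. intros s Hs.
        apply @continuous_mult; [|apply Ccos]. apply @continuous_mult; [|apply Hh'].
        exact (is_derive_continuous _ _ _ (HB s (HD s Hs))).
    + exact ICu.
  - lra.
  - rewrite Hu0. ring.
  - intros s Hs. split; [apply is_derive_scal, Hu, HD, Hs|].
    apply @continuous_mult; [apply continuous_const | apply Cu', HD, Hs]. }
assert (Emain : sqrt (PI / (2 * m * t)) = / (sqrt w0 * sqrt t) * (sqrt PI / 2)).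
{ apply sqrt_lem_1.
  - left. apply Rdiv_lt_0_compat; [apply PI_RGT_0|]. apply Rmult_lt_0_compat; lra.
  - left. apply Rmult_lt_0_compat; [apply Rinv_0_lt_compat; now apply Rmult_lt_0_compat|].
    apply Rdiv_lt_0_compat; [apply sqrt_lt_R0, PI_RGT_0 | lra].
  - transitivity (sqrt PI ^ 2 / (4 * sqrt w0 ^ 2 * sqrt t ^ 2)); [field; lra|].
    rewrite !pow2_sqrt by (try (left; apply PI_RGT_0); unfold w0; lra).
    unfold w0. rewrite Hw0. field. lra. }
assert (Ht2 : sqrt t * sqrt t = t) by (apply sqrt_sqrt; lra).
rewrite EI, Emain. fold gam.
replace (_ - _) with (/ (sqrt w0 * sqrt t) *
  (fresnel gam (sqrt t * u d) - sqrt PI / 2 * cos (gam + PI / 4))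
  + RInt (fun s => B s * h' s * cos (t * h s + beta)) 0 d) by ring.
eapply Rle_trans; [apply Rabs_triang|].
rewrite Rdiv_plus_distr. apply Rplus_le_compat.
- rewrite Rabs_mult.
  rewrite Rabs_pos_eq by (left; apply Rinv_0_lt_compat; now apply Rmult_lt_0_compat).
  replace (1800 / (sqrt w0 * u d) / t) with
    (/ (sqrt w0 * sqrt t) * (1800 / (sqrt t * u d))).
  + apply Rmult_le_compat_l.
    * left. apply Rinv_0_lt_compat. now apply Rmult_lt_0_compat.
    * apply fresnel_asymptotic. now apply Rmult_lt_0_compat.
  + rewrite <- Ht2 at 3. field. lra.
- apply oscillating_by_parts_bound; [lra|exact Ht| |].
  + intros s Hs. split; [apply HB, HD, Hs | apply HB', HD, Hs].
  + intros s Hs. split; [apply Hd | apply Hh'].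
Qed.

Definition stationary_term (phi phi'' : R -> R) (p t beta : R) : R :=
  sqrt (2 * PI / (Rabs (phi'' p) * t))
  * cos (t * phi p + beta + sign (phi'' p) * (PI / 4)).

Lemma sign_sqr y : y <> 0 -> sign y * sign y = 1.
Proof.
intros H. destruct (Rdichotomy _ _ H) as [H1|H1];
  [rewrite sign_eq_m1 | rewrite sign_eq_1]; lra.
Qed.

Lemma cos_sign_mult s y : s <> 0 -> cos (sign s * y) = cos y.
Proof.
intros H. destruct (Rdichotomy _ _ H) as [H1|H1].
- rewrite sign_eq_m1 by exact H1. rewrite <- (cos_neg y). f_equal. ring.
- rewrite sign_eq_1 by exact H1. f_equal. ring.
Qed.

(** Either direction ([e = 1] or [e = -1]) away from a stationary point of either
    kind; changing the sign of the phase turns a maximum into a minimum. *)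
Lemma half_stationary_phase_at (phi phi' phi'' : R -> R) (x e : R) :
  class_C everywhere 8 phi -> (forall y, is_derive phi y (phi' y)) ->
  (forall y, is_derive phi' y (phi'' y)) ->
  phi' x = 0 -> phi'' x <> 0 -> e * e = 1 ->
  exists delta, 0 < delta /\
    (forall s, s <> 0 -> Rabs s < delta -> phi' (x + e * s) <> 0) /\
    forall d, 0 < d < delta -> exists C, forall t beta, 0 < t ->
      Rabs (RInt (fun s => cos (t * phi (x + e * s) + beta)) 0 d
            - / 2 * stationary_term phi phi'' x t beta) <= C / t.
Proof.
intros HC H1 H2 H0 Hnz He.
set (sg := sign (phi'' x)). assert (Hsg := sign_sqr _ Hnz). fold sg in Hsg.
assert (Hm : 0 < Rabs (phi'' x)) by now apply Rabs_pos_lt.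
assert (Haff : forall s, is_derive (fun s => x + e * s) s e)
  by (intros s; auto_derive; [easy | ring]).
destruct (half_stationary_phase (fun s => sg * phi (x + e * s))
  (fun s => sg * (e * phi' (x + e * s))) (Rabs (phi'' x))) as [delta [Hdelta [Hne Hd]]].
- apply class_C_scal, class_C_comp_affine, HC.
- intros s. apply is_derive_scal.
  exact (is_derive_comp phi (fun s => x + e * s) s _ _ (H1 _) (Haff s)).
- rewrite Rmult_0_r, Rplus_0_r, H0. ring.
- replace (Rabs (phi'' x)) with (sg * (e * (e * phi'' (x + e * 0)))).
  + do 2 apply is_derive_scal.
    exact (is_derive_comp phi' (fun s => x + e * s) 0 _ _ (H2 _) (Haff 0)).
  + rewrite Rmult_0_r, Rplus_0_r.
    rewrite <- (Rmult_assoc e), He, Rmult_1_l. unfold sg.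
    destruct (Rdichotomy _ _ Hnz) as [L|G].
    * rewrite sign_eq_m1, Rabs_left by exact L. ring.
    * rewrite sign_eq_1, Rabs_pos_eq by lra. ring.
- exact Hm.
- exists delta. split; [exact Hdelta|]. split.
  + intros s Hs Hsd E. apply (Hne s Hs Hsd). rewrite E. ring.
  + intros d Hdd. destruct (Hd d Hdd) as [C HCb]. exists C. intros t beta Ht.
    specialize (HCb t (sg * beta) Ht). rewrite Rmult_0_r, Rplus_0_r in HCb.
    rewrite (RInt_ext _ (fun s => cos (t * phi (x + e * s) + beta))) in HCb.
    2: { intros s _. rewrite <- (cos_sign_mult (phi'' x) (_ + beta)) by exact Hnz.
         fold sg. f_equal. ring. }
    replace (/ 2 * _) with
      (sqrt (PI / (2 * Rabs (phi'' x) * t)) * cos (t * (sg * phi x) + sg * beta + PI / 4));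
      [exact HCb|].
    unfold stationary_term. rewrite <- (Rmult_assoc (/ 2)). f_equal.
    * pose proof PI_RGT_0.
      assert (0 < Rabs (phi'' x) * t) by now apply Rmult_lt_0_compat.
      apply sqrt_lem_1.
      { left. apply Rdiv_lt_0_compat; lra. }
      { apply Rmult_le_pos; [lra | apply sqrt_pos]. }
      transitivity (/ 4 * (sqrt (2 * PI / (Rabs (phi'' x) * t))
        * sqrt (2 * PI / (Rabs (phi'' x) * t))));
        [field|].
      rewrite sqrt_sqrt by (left; apply Rdiv_lt_0_compat; lra). field. lra.
    * rewrite <- (cos_sign_mult (phi'' x)) by exact Hnz. fold sg. f_equal.
      transitivity (sg * sg * (t * phi x + beta) + sg * (PI / 4)); [ring|].
      rewrite Hsg. ring.
Qed.

(** * Assembling the contributions over an interval *)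

Lemma nonstationary_segment (phi phi' phi'' : R -> R) (a b : R) :
  a <= b -> (forall y, is_derive phi y (phi' y)) ->
  (forall y, is_derive phi' y (phi'' y)) -> (forall y, continuous phi'' y) ->
  (forall y, a <= y <= b -> phi' y <> 0) ->
  exists C, forall t beta, 0 < t ->
    Rabs (RInt (fun y => cos (t * phi y + beta)) a b) <= C / t.
Proof.
intros Hab H1 H2 Hc Hnz.
set (B' := fun y => - phi'' y / phi' y ^ 2).
exists (Rabs (/ phi' a) + Rabs (/ phi' b) + RInt (fun y => Rabs (B' y)) a b).
intros t beta Ht.
rewrite (RInt_ext _ (fun y => / phi' y * phi' y * cos (t * phi y + beta))).
2: { rewrite Rmin_left, Rmax_right by lra. intros y Hy.
     rewrite Rinv_l by (apply Hnz; lra). symmetry. apply Rmult_1_l. }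
apply (oscillating_by_parts_bound (fun y => / phi' y)); [exact Hab|exact Ht| |].
- intros y Hy. specialize (Hnz y Hy). split; [apply is_derive_inv; auto|].
  apply @continuous_mult.
  + apply (continuous_opp (V := R_NormedModule)), Hc.
  + apply (continuous_Rinv_comp (fun y => phi' y ^ 2)); [|now apply pow_nonzero].
    apply (continuous_comp phi' (fun z => z ^ 2));
      [exact (is_derive_continuous _ _ _ (H2 y))|].
    apply (is_derive_continuous (fun z : R => z ^ 2) _ (2 * phi' y)).
    auto_derive; [easy | ring].
- intros y _. split; [apply H1 | exact (is_derive_continuous _ _ _ (H2 y))].
Qed.

(** Continuous induction: the supremum of the right ends reached from [a] is
    reached itself, by a short segment to its left, and a short segment to its
    right would pass it unless it is [b]. *)
Lemma segment_induction (Q : R -> R -> Prop) (a b : R) :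
  a < b ->
  (forall x y z, a <= x < y -> y < z <= b -> Q x y -> Q y z -> Q x z) ->
  (forall x, a <= x <= b -> exists delta, 0 < delta /\
     (forall u, x < u < x + delta -> Q x u) /\
     (forall u, x - delta < u < x -> Q u x)) ->
  Q a b.
Proof.
intros Hab Hadd Hloc.
set (E := fun x => a < x <= b /\ Q a x).
destruct (Hloc a ltac:(lra)) as [da [Hda [Ra _]]].
assert (HEa : E (Rmin b (a + da / 2))).
{ split; [split|].
  - apply Rmin_glb_lt; lra.
  - apply Rmin_l.
  - apply Ra. split; [apply Rmin_glb_lt; lra|].
    eapply Rle_lt_trans; [apply Rmin_r | lra]. }
destruct (completeness E) as [s [Hub Hlub]].
- exists b. intros x [Hx _]. lra.
- now exists (Rmin b (a + da / 2)).
- assert (Has : a < s) by (pose proof (Hub _ HEa); pose proof (proj1 (proj1 HEa)); lra).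
  assert (Hsb : s <= b) by (apply Hlub; intros x [Hx _]; lra).
  destruct (Hloc s ltac:(lra)) as [d [Hd [Rs Ls]]].
  assert (HQs : Q a s).
  { destruct (Classical_Prop.classic (exists x, E x /\ s - d < x)) as [[x [Hx Hxd]]|N].
    - pose proof (Hub x Hx). destruct Hx as [Hx HQ].
      destruct (Req_dec x s) as [->|Hne]; [exact HQ|].
      apply (Hadd a x s); [lra|lra|exact HQ|]. apply Ls. lra.
    - assert (s <= s - d); [|lra]. apply Hlub. intros x Hx.
      destruct (Rle_dec x (s - d)) as [H|H]; [exact H|].
      exfalso. apply N. exists x. split; [exact Hx | lra]. }
  destruct (Req_dec s b) as [<-|Hne]; [exact HQs|]. exfalso.
  set (u := Rmin b (s + d / 2)).
  assert (Hsu : s < u) by (apply Rmin_glb_lt; lra).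
  assert (Hub' : u <= b) by apply Rmin_l.
  assert (Hu2 : u <= s + d / 2) by apply Rmin_r.
  assert (HE : E u).
  { split; [lra|]. apply (Hadd a s u); [lra|lra|exact HQs|]. apply Rs. lra. }
  specialize (Hub u HE). lra.
Qed.

Lemma continuous_nonzero_near (f : R -> R) (x : R) :
  continuous f x -> f x <> 0 ->
  exists d, 0 < d /\ forall y, Rabs (y - x) < d -> f y <> 0.
Proof.
intros Hc Hp.
destruct (Hc (fun y => y <> 0)) as [d Hd].
- exists (mkposreal _ (Rabs_pos_lt _ Hp)). intros y Hy E. subst y.
  unfold ball in Hy; simpl in Hy;
    unfold AbsRing_ball, abs, minus, plus, opp in Hy; simpl in Hy.
  rewrite Rplus_0_l, Rabs_Ropp in Hy. lra.
- exists d. split; [apply cond_pos|]. intros y Hy. now apply Hd.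
Qed.

(** [G] accumulates the contributions from left to right: it jumps by half of the
    stationary term on each side of a stationary point and is constant in
    between.  With half jumps the claim is additive even where segments meet at a
    stationary point, and the ends of the interval may be stationary. *)
Lemma stationary_phase_interval (phi phi' phi'' : R -> R) (G : R -> R -> R -> R) (a b : R) :
  a < b -> class_C everywhere 8 phi -> (forall y, is_derive phi y (phi' y)) ->
  (forall y, is_derive phi' y (phi'' y)) -> (forall y, continuous phi'' y) ->
  (forall x, a <= x <= b -> phi' x = 0 -> phi'' x <> 0) ->
  (forall x u, x < u ->
     (forall y, x <= y <= u -> phi' y <> 0) ->
     forall t beta, G u t beta = G x t beta) ->
  (forall x u, a <= x <= b -> phi' x = 0 -> x < u ->
     (forall y, x < y <= u -> phi' y <> 0) ->
     forall t beta, G u t beta - G x t beta = / 2 * stationary_term phi phi'' x t beta) ->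
  (forall x u, a <= x <= b -> phi' x = 0 -> u < x ->
     (forall y, u <= y < x -> phi' y <> 0) ->
     forall t beta, G x t beta - G u t beta = / 2 * stationary_term phi phi'' x t beta) ->
  exists C, forall t beta, 0 < t ->
    Rabs (RInt (fun y => cos (t * phi y + beta)) a b - (G b t beta - G a t beta)) <= C / t.
Proof.
intros Hab HC H1 H2 Hc Hnd Gc Gr Gl.
assert (Hcos : forall t beta u v, ex_RInt (fun y => cos (t * phi y + beta)) u v).
{ intros t beta u v. apply @ex_RInt_continuous. intros y _.
  exact (continuous_cos_phase _ _ _ _ (is_derive_continuous _ _ _ (H1 y))). }
apply (segment_induction (fun u v => exists C, forall t beta, 0 < t ->
  Rabs (RInt (fun y => cos (t * phi y + beta)) u v - (G v t beta - G u t beta)) <= C / t));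
  [exact Hab| |].
- intros x y z _ _ [C1 Q1] [C2 Q2]. exists (C1 + C2). intros t beta Ht.
  specialize (Q1 t beta Ht). specialize (Q2 t beta Ht).
  rewrite (RInt_concat _ x y z) by apply Hcos. rewrite Rdiv_plus_distr.
  replace (_ - _) with
    ((RInt (fun y => cos (t * phi y + beta)) x y - (G y t beta - G x t beta)) +
     (RInt (fun y => cos (t * phi y + beta)) y z - (G z t beta - G y t beta))) by ring.
  eapply Rle_trans; [apply Rabs_triang|]. lra.
- intros x Hx. destruct (Req_dec (phi' x) 0) as [H0|H0].
  + assert (Hxnd := Hnd x Hx H0).
    destruct (half_stationary_phase_at phi phi' phi'' x 1) as [d1 [Hd1 [N1 B1]]];
      try assumption; [ring|].
    destruct (half_stationary_phase_at phi phi' phi'' x (-1)) as [d2 [Hd2 [N2 B2]]];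
      try assumption; [ring|].
    exists (Rmin d1 d2). pose proof (Rmin_l d1 d2). pose proof (Rmin_r d1 d2).
    split; [now apply Rmin_pos|]. split.
    * intros u Hu. destruct (B1 (u - x) ltac:(lra)) as [C HB]. exists C.
      intros t beta Ht. rewrite (Gr x u Hx H0); [|lra|].
      2: { intros y Hy. replace y with (x + 1 * (y - x)) by ring.
           apply N1; [lra | rewrite Rabs_pos_eq; lra]. }
      replace (RInt _ x u) with (RInt (fun s => cos (t * phi (x + 1 * s) + beta)) 0 (u - x));
        [now apply HB|].
      transitivity (RInt (fun s => 1 * cos (t * phi (1 * s + x) + beta)) 0 (u - x)).
      -- apply RInt_ext. intros s _. rewrite !Rmult_1_l. now rewrite (Rplus_comm x).
      -- generalize (RInt_comp_lin (V := R_CompleteNormedModule)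
           (fun y => cos (t * phi y + beta)) 1 x 0 (u - x)).
         replace (1 * 0 + x) with x by ring. replace (1 * (u - x) + x) with u by ring.
         intros E. apply E, Hcos.
    * intros u Hu. destruct (B2 (x - u) ltac:(lra)) as [C HB]. exists C.
      intros t beta Ht. rewrite (Gl x u Hx H0); [|lra|].
      2: { intros y Hy. replace y with (x + -1 * (x - y)) by ring.
           apply N2; [lra | rewrite Rabs_pos_eq; lra]. }
      replace (RInt _ u x) with (RInt (fun s => cos (t * phi (x + -1 * s) + beta)) 0 (x - u));
        [now apply HB|].
      transitivity (- RInt (fun s => -1 * cos (t * phi (-1 * s + x) + beta)) 0 (x - u)).
      -- rewrite RInt_scal_l.
         ++ rewrite (RInt_ext _ (fun s => cos (t * phi (-1 * s + x) + beta))); [lra|].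
            intros s _. now rewrite (Rplus_comm x).
         ++ apply @ex_RInt_continuous. intros y _.
            apply (continuous_cos_phase (fun s => phi (-1 * s + x))).
            apply (continuous_comp (fun s => -1 * s + x) phi);
              [|exact (is_derive_continuous _ _ _ (H1 _))].
            apply (is_derive_continuous _ _ (-1)). auto_derive; [easy | ring].
      -- generalize (RInt_comp_lin (V := R_CompleteNormedModule)
           (fun y => cos (t * phi y + beta)) (-1) x 0 (x - u)).
         replace (-1 * 0 + x) with x by ring. replace (-1 * (x - u) + x) with u by ring.
         intros E. transitivity (- RInt (fun y => cos (t * phi y + beta)) x u).
         ++ f_equal. apply E, Hcos.
         ++ exact (opp_RInt_swap (V := R_CompleteNormedModule) _ _ _ (Hcos t beta x u)).
  + destruct (continuous_nonzero_near phi' x) as [d [Hd Nd]];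
      [exact (is_derive_continuous _ _ _ (H2 x)) | exact H0|].
    exists d. split; [exact Hd|]. split; intros u Hu;
    [ assert (N : forall y, x <= y <= u -> phi' y <> 0)
        by (intros y Hy; apply Nd, Rabs_lt_between; lra);
      destruct (nonstationary_segment phi phi' phi'' x u) as [C HB]
    | assert (N : forall y, u <= y <= x -> phi' y <> 0)
        by (intros y Hy; apply Nd, Rabs_lt_between; lra);
      destruct (nonstationary_segment phi phi' phi'' u x) as [C HB] ];
    try assumption; try lra; exists C; intros t beta Ht;
      [rewrite (Gc x u) | rewrite (Gc u x)]; try assumption; try lra;
      unfold Rminus; rewrite Rplus_opp_r, Ropp_0, Rplus_0_r; now apply HB.
Qed.

(** * The amplitude as an oscillatory integral *)

Lemma is_derive_n_cos_affine (c beta : R) (k : nat) (y : R) :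
  is_derive_n (fun y => cos (c * y + beta)) k y (c ^ k * cos (c * y + (beta + INR k * (PI / 2)))).
Proof.
revert y; induction k as [|k IH]; intros y.
- simpl. rewrite Rmult_1_l. do 2 f_equal. ring.
- change (is_derive (Derive_n (fun y => cos (c * y + beta)) k) y
    (c ^ S k * cos (c * y + (beta + INR (S k) * (PI / 2))))).
  apply (is_derive_ext (fun y => c ^ k * cos (c * y + (beta + INR k * (PI / 2))))).
  + intros z. symmetry. apply is_derive_n_unique, IH.
  + auto_derive; [easy|]. rewrite S_INR.
    replace (c * y + (beta + (INR k + 1) * (PI / 2)))
      with (PI / 2 + (c * y + (beta + INR k * (PI / 2)))) by ring.
    rewrite <- (Ropp_involutive (cos (PI / 2 + _))), <- sin_cos. simpl. ring.
Qed.

(** Taylor's formula for a cosine; quarter-turns of the phase are its derivatives. *)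
Lemma cos_Taylor_bound (x beta : R) (n : nat) :
  Rabs (cos (x + beta) - sum_n (fun k => x ^ k / INR (fact k) * cos (beta + INR k * (PI / 2))) n)
  <= Rabs x ^ S n / INR (fact (S n)).
Proof.
assert (Hfact := INR_fact_lt_0 (S n)).
destruct (Req_dec x 0) as [->|Hx].
{ assert (E : sum_n (fun k => 0 ^ k / INR (fact k) * cos (beta + INR k * (PI / 2))) n = cos beta).
  { clear. induction n as [|n IH].
    - rewrite sum_O. simpl. rewrite Rmult_0_l, Rplus_0_r. field.
    - rewrite sum_Sn, IH. rewrite pow_i by lia. unfold plus; simpl.
      unfold Rdiv. rewrite !Rmult_0_l. ring. }
  rewrite E, Rplus_0_l. unfold Rminus. rewrite Rplus_opp_r, Rabs_R0.
  rewrite pow_i by lia. unfold Rdiv. lra. }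
set (c := sign x).
assert (Ex : x = c * Rabs x).
{ unfold c. destruct (Rdichotomy _ _ Hx) as [L|G].
  - rewrite sign_eq_m1, Rabs_left by exact L. ring.
  - rewrite sign_eq_1, Rabs_pos_eq by lra. ring. }
assert (Hc : Rabs c = 1).
{ unfold c. destruct (Rdichotomy _ _ Hx) as [L|G].
  - rewrite sign_eq_m1 by exact L. rewrite Rabs_left; lra.
  - rewrite sign_eq_1 by exact G. apply Rabs_R1. }
destruct (Taylor_Lagrange (fun y => cos (c * y + beta)) n 0 (Rabs x)) as [z [_ E]].
- now apply Rabs_pos_lt.
- intros y _ k _. destruct k as [|k]; [easy|].
  exact (ex_intro _ _ (is_derive_n_cos_affine c beta (S k) y)).
- rewrite <- Ex, Rminus_0_r in E. rewrite E.
  rewrite (is_derive_n_unique _ _ _ _ (is_derive_n_cos_affine c beta (S n) z)).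
  rewrite sum_n_Reals.
  rewrite (sum_eq _ (fun k => x ^ k / INR (fact k) * cos (beta + INR k * (PI / 2)))).
  2: { intros k _.
       rewrite (is_derive_n_unique _ _ _ _ (is_derive_n_cos_affine c beta k 0)).
       rewrite Rmult_0_r, Rplus_0_l. rewrite Ex at 2. rewrite Rpow_mult_distr.
       unfold Rdiv. ring. }
  match goal with |- Rabs (?A + ?B - ?A) <= _ => replace (A + B - A) with B by ring end.
  rewrite !Rabs_mult, <- RPow_abs, Hc, pow1, Rmult_1_l.
  unfold Rdiv. rewrite Rabs_mult.
  rewrite (Rabs_pos_eq (/ _)) by (left; now apply Rinv_0_lt_compat).
  rewrite <- RPow_abs, Rabs_Rabsolu.
  set (q := _ * / _). rewrite <- (Rmult_1_r q) at 2.
  apply Rmult_le_compat_l.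
  + unfold q. apply Rmult_le_pos; [apply pow_le, Rabs_pos|].
    left; now apply Rinv_0_lt_compat.
  + apply Rabs_le, COS_bound.
Qed.

Lemma two_PI_pos : 0 < 2 * PI.
Proof. pose proof PI_RGT_0. lra. Qed.

(** The Taylor remainder is uniform over the period, hence the sum may be taken
    under the integral. *)
Lemma Series_exponential_integral (c : nat -> R) (y beta : R -> R) :
  (forall x, continuous y x) -> (forall x, continuous beta x) ->
  (forall k, is_RInt (fun x => y x ^ k / INR (fact k) * cos (beta x + INR k * (PI / 2)))
               0 (2 * PI) (2 * PI * c k)) ->
  2 * PI * Series c = RInt (fun x => cos (y x + beta x)) 0 (2 * PI).
Proof.
intros Hy Hbeta Hc. pose proof two_PI_pos as HP.
set (J := RInt (fun x => cos (y x + beta x)) 0 (2 * PI) : R).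
change (2 * PI * Series c = J).
assert (HJ : is_RInt (fun x => cos (y x + beta x)) 0 (2 * PI) J).
{ apply (RInt_correct (V := R_CompleteNormedModule)), @ex_RInt_continuous. intros x _.
  apply (continuous_comp (fun x => y x + beta x) cos); [|apply continuous_cos].
  apply @continuous_plus; auto. }
destruct (continuity_ab_maj (fun x => Rabs (y x)) 0 (2 * PI)) as [xM [HM _]]; [lra| |].
{ intros x _. apply continuity_pt_filterlim.
  apply (continuous_comp y Rabs); [apply Hy | apply continuous_Rabs]. }
set (M := Rabs (y xM)) in *.
assert (Hpart : forall n, is_RInt (fun x => sum_n (fun k => y x ^ k / INR (fact k)
    * cos (beta x + INR k * (PI / 2))) n) 0 (2 * PI) (2 * PI * sum_n c n)).
{ induction n as [|n IH].
  - rewrite sum_O. eapply is_RInt_ext; [|apply Hc]. intros x _. now rewrite sum_O.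
  - rewrite sum_Sn. change plus with Rplus. rewrite Rmult_plus_distr_l.
    eapply is_RInt_ext; [|apply (is_RInt_plus (V := R_NormedModule)); [exact IH | apply Hc]].
    intros x _. now rewrite sum_Sn. }
assert (Herr : forall n, Rabs (J - 2 * PI * sum_n c n) <= 2 * PI * (M ^ S n / INR (fact (S n)))).
{ intros n.
  pose proof (is_RInt_minus (V := R_NormedModule) _ _ _ _ _ _ HJ (Hpart n)) as HD.
  apply (norm_RInt_le_const (V := R_NormedModule) _ 0 (2 * PI) _
    (M ^ S n / INR (fact (S n)))) in HD.
  - rewrite Rminus_0_r in HD. exact HD.
  - lra.
  - intros x Hx. eapply Rle_trans; [apply cos_Taylor_bound|].
    apply Rmult_le_compat_r; [left; apply Rinv_0_lt_compat, INR_fact_lt_0|].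
    apply pow_incr. split; [apply Rabs_pos | now apply HM]. }
assert (HS : is_series c (J / (2 * PI))).
{ apply is_lim_seq_Reals. intros eps Heps.
  destruct (cv_speed_pow_fact M eps Heps) as [N HN].
  exists N. intros n Hn. unfold R_dist. rewrite Rabs_minus_sym.
  specialize (HN (S n) ltac:(lia)). unfold R_dist in HN. rewrite Rminus_0_r in HN.
  apply Rle_lt_trans with (M ^ S n / INR (fact (S n))).
  - apply Rmult_le_reg_l with (2 * PI); [exact HP|].
    rewrite <- (Rabs_pos_eq (2 * PI)) at 1 by lra. rewrite <- Rabs_mult.
    eapply Rle_trans; [right|apply (Herr n)]. f_equal.
    transitivity (2 * PI * (J / (2 * PI) - sum_n c n)); [reflexivity | field; lra].
  - eapply Rle_lt_trans; [apply Rle_abs | exact HN]. }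
rewrite (is_series_unique _ _ HS). field. lra.
Qed.

(** Taken by components, so that complex scalars act on the integral. *)
Definition is_periodInt (f : R -> C) (z : C) : Prop :=
  is_RInt (fun x => Re (f x)) 0 (2 * PI) (Re z) /\
  is_RInt (fun x => Im (f x)) 0 (2 * PI) (Im z).

Lemma is_periodInt_ext f g z :
  (forall x, f x = g x) -> is_periodInt f z -> is_periodInt g z.
Proof.
intros E [H1 H2]. split.
- apply (is_RInt_ext (fun x => Re (f x))); [|exact H1]. intros x _. now rewrite E.
- apply (is_RInt_ext (fun x => Im (f x))); [|exact H2]. intros x _. now rewrite E.
Qed.

Lemma is_periodInt_plus f g z w :
  is_periodInt f z -> is_periodInt g w ->
  is_periodInt (fun x => Cplus (f x) (g x)) (Cplus z w).
Proof.
intros [H1 H2] [H3 H4]. split; now apply (is_RInt_plus (V := R_NormedModule)).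
Qed.

Lemma is_periodInt_mult_r f z c :
  is_periodInt f z -> is_periodInt (fun x => Cmult (f x) c) (Cmult z c).
Proof.
intros [H1 H2].
assert (S1 := fun r => is_RInt_scal (V := R_NormedModule) _ _ _ r _ H1).
assert (S2 := fun r => is_RInt_scal (V := R_NormedModule) _ _ _ r _ H2).
split.
- generalize (is_RInt_minus (V := R_NormedModule) _ _ _ _ _ _ (S1 (Re c)) (S2 (Im c))).
  replace (Re (z * c)%C) with (minus (scal (Re c) (Re z)) (scal (Im c) (Im z))).
  + apply is_RInt_ext. intros x _. unfold minus, plus, opp, scal; simpl; unfold mult; simpl.
    unfold Re, Im. ring.
  + unfold minus, plus, opp, scal; simpl; unfold mult; simpl. unfold Re, Im. ring.
- generalize (is_RInt_plus (V := R_NormedModule) _ _ _ _ _ _ (S1 (Im c)) (S2 (Re c))).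
  replace (Im (z * c)%C) with (plus (scal (Im c) (Re z)) (scal (Re c) (Im z))).
  + apply is_RInt_ext. intros x _. unfold plus, scal; simpl; unfold mult; simpl.
    unfold Re, Im. ring.
  + unfold plus, scal; simpl; unfold mult; simpl. unfold Re, Im. ring.
Qed.

Lemma is_periodInt_zsum L (f : Z -> R -> C) (z : Z -> C) :
  (forall d, is_periodInt (f d) (z d)) ->
  is_periodInt (fun x => zsum L (fun d => f d x)) (zsum L z).
Proof.
intros H. unfold zsum. generalize (2 * L)%nat as n. induction n as [|n IH].
- rewrite sum_O. eapply is_periodInt_ext; [|apply H]. intros x. now rewrite sum_O.
- rewrite sum_Sn. eapply is_periodInt_ext; [|apply is_periodInt_plus; [exact IH | apply H]].
  intros x. now rewrite sum_Sn.
Qed.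

Lemma expi_plus x y : expi (x + y) = Cmult (expi x) (expi y).
Proof.
unfold expi, Cmult; simpl. rewrite cos_plus, sin_plus. f_equal. ring.
Qed.

Lemma zsum_mult_l L c f : zsum L (fun d => Cmult c (f d)) = Cmult c (zsum L f).
Proof. apply (sum_n_mult_l (K := C_Ring)). Qed.

Lemma expi_PI2_mult k : expi (INR k * (PI / 2)) = Cpow Ci k.
Proof.
induction k as [|k IH].
- simpl. unfold expi. now rewrite Rmult_0_l, cos_0, sin_0.
- rewrite S_INR, Rmult_plus_distr_r, Rmult_1_l, expi_plus, IH.
  simpl. rewrite Cmult_comm. f_equal. unfold expi, Ci. now rewrite cos_PI2, sin_PI2.
Qed.

Lemma sin_cos_period (l : Z) (x : R) :
  cos (IZR l * (2 * PI) + x) = cos x /\ sin (IZR l * (2 * PI) + x) = sin x.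
Proof.
destruct (Z_le_gt_dec 0 l) as [H|H].
- replace (IZR l) with (INR (Z.to_nat l)) by (rewrite INR_IZR_INZ, Z2Nat.id; [easy|lia]).
  replace (_ + x) with (x + 2 * INR (Z.to_nat l) * PI) by ring.
  now rewrite cos_period, sin_period.
- replace (IZR l) with (- INR (Z.to_nat (- l))).
  2: { rewrite INR_IZR_INZ, Z2Nat.id by lia. rewrite opp_IZR. ring. }
  set (y := _ + x). replace x with (y + 2 * INR (Z.to_nat (- l)) * PI) by (unfold y; ring).
  now rewrite cos_period, sin_period.
Qed.

Lemma is_periodInt_expi (l : Z) :
  is_periodInt (fun x => expi (IZR l * x))
    (Cmult (RtoC (2 * PI)) (if Z.eq_dec 0 l then RtoC 1 else RtoC 0)).
Proof.
destruct (Z.eq_dec 0 l) as [<-|Hl].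
- split; simpl.
  + replace (2 * PI * 1 - 0 * 0) with (scal (2 * PI - 0) 1)
      by (unfold scal; simpl; unfold mult; simpl; ring).
    apply (is_RInt_ext (fun _ => 1)); [|apply (is_RInt_const (V := R_NormedModule))].
    intros x _. now rewrite Rmult_0_l, cos_0.
  + replace (2 * PI * 0 + 0 * 1) with (scal (2 * PI - 0) 0)
      by (unfold scal; simpl; unfold mult; simpl; ring).
    apply (is_RInt_ext (fun _ => 0)); [|apply (is_RInt_const (V := R_NormedModule))].
    intros x _. now rewrite Rmult_0_l, sin_0.
- assert (Hlr : IZR l <> 0) by (apply not_0_IZR; lia).
  destruct (sin_cos_period l 0) as [Ec Es]. rewrite Rplus_0_r in Ec, Es.
  split; simpl.
  + replace (2 * PI * 0 - 0 * 0) with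
      (minus (sin (IZR l * (2 * PI)) / IZR l) (sin (IZR l * 0) / IZR l)).
    2: { rewrite Rmult_0_r, Es. unfold minus, plus, opp; simpl. lra. }
    apply (is_RInt_derive (fun x => sin (IZR l * x) / IZR l)).
    * intros x _. auto_derive; [easy | field; easy].
    * intros x _. apply (is_derive_continuous _ _ (- (IZR l * sin (IZR l * x)))).
      auto_derive; [easy | ring].
  + replace (2 * PI * 0 + 0 * 0) with
      (minus (- cos (IZR l * (2 * PI)) / IZR l) (- cos (IZR l * 0) / IZR l)).
    2: { rewrite Rmult_0_r, Ec. unfold minus, plus, opp; simpl. lra. }
    apply (is_RInt_derive (fun x => - cos (IZR l * x) / IZR l)).
    * intros x _. auto_derive; [easy | field; easy].
    * intros x _. apply (is_derive_continuous _ _ (IZR l * cos (IZR l * x))).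
      auto_derive; [easy | ring].
Qed.

(** The powers of a convolution matrix are the Fourier coefficients of the powers
    of its symbol [P]; the exponent is [+ l] because the entry at [(0, l)] is the
    coefficient of index [0 - l]. *)
Lemma mxpow_Fourier L X a k l :
  isotropic X a ->
  is_periodInt (fun x => Cmult (RtoC (genP L a x ^ k)) (expi (IZR l * x)))
    (Cmult (RtoC (2 * PI)) (mxpow L X k 0 l)).
Proof.
intros Hiso. revert l; induction k as [|k IH]; intros l.
- eapply is_periodInt_ext; [|apply is_periodInt_expi].
  intros x. simpl. now rewrite Cmult_1_l.
- cbn [mxpow]. rewrite <- zsum_mult_l.
  eapply is_periodInt_ext; [|apply is_periodInt_zsum].
  2: { intros d. rewrite Cmult_assoc. apply is_periodInt_mult_r, IH. }
  intros x. cbv beta. simpl pow. rewrite RtoC_mult, <- (gen_fun_real X L a x Hiso).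
  unfold gen_fun.
  rewrite (Cmult_comm (zsum _ _)), <- Cmult_assoc, (Cmult_comm (zsum _ _)), Cmult_assoc.
  rewrite <- zsum_mult_l. unfold zsum. apply sum_n_ext. intros n.
  set (d := (Z.of_nat n - Z.of_nat L)%Z).
  rewrite (proj1 Hiso). replace (l + d - l)%Z with d by lia.
  rewrite plus_IZR, Rmult_plus_distr_r, expi_plus.
  match goal with |- ?A = ?B => change (@eq C A B) end. ring.
Qed.

Lemma amplitude_term_integral L X a l t k :
  isotropic X a ->
  is_periodInt (fun x => Cmult (RtoC ((t * genP L a x) ^ k / INR (fact k)))
                               (expi (IZR l * x + INR k * (PI / 2))))
    (Cmult (RtoC (2 * PI)) (amplitude_term L X l t k)).
Proof.
intros Hiso. unfold amplitude_term, Cdiv.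
rewrite <- Cmult_assoc, Cmult_assoc.
eapply is_periodInt_ext; [|apply is_periodInt_mult_r, mxpow_Fourier, Hiso].
intros x. cbv beta. rewrite expi_plus, expi_PI2_mult, Cpow_mult_l.
rewrite Rpow_mult_distr. unfold Rdiv.
rewrite !RtoC_mult, RtoC_inv, !RtoC_pow by apply INR_fact_neq_0.
ring.
Qed.

Lemma amplitude_integral L X a l t :
  isotropic X a -> (forall x, continuous (genP L a) x) ->
  2 * PI * Re (amplitude L X l t) =
    RInt (fun x => cos (t * genP L a x + IZR l * x)) 0 (2 * PI) /\
  2 * PI * Im (amplitude L X l t) =
    RInt (fun x => cos (t * genP L a x + (IZR l * x - PI / 2))) 0 (2 * PI).
Proof.
intros Hiso Hc.
assert (Hy : forall x, continuous (fun x => t * genP L a x) x).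
{ intros x. apply @continuous_mult; [apply continuous_const | apply Hc]. }
assert (Hl : forall b x, continuous (fun x => IZR l * x + b) x).
{ intros b x. apply (is_derive_continuous _ _ (IZR l)). auto_derive; [easy | ring]. }
assert (H := fun k => amplitude_term_integral L X a l t k Hiso).
split.
- apply (Series_exponential_integral (fun k => Re (amplitude_term L X l t k))
    (fun x => t * genP L a x) (fun x => IZR l * x)); [exact Hy| |].
  + intros x. apply (continuous_ext (fun x => IZR l * x + 0));
      [intros z; apply Rplus_0_r | apply Hl].
  + intros k. destruct (H k) as [H1 _].
    replace (2 * PI * _) with (Re (RtoC (2 * PI) * amplitude_term L X l t k)%C).
    2: { unfold Re; simpl. ring. }
    revert H1. apply is_RInt_ext. intros x _. unfold Re; simpl. ring.
- apply (Series_exponential_integral (fun k => Im (amplitude_term L X l t k))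
    (fun x => t * genP L a x) (fun x => IZR l * x - PI / 2)); [exact Hy|apply Hl|].
  intros k. destruct (H k) as [_ H1].
  replace (2 * PI * _) with (Im (RtoC (2 * PI) * amplitude_term L X l t k)%C).
  2: { unfold Im; simpl. ring. }
  revert H1. apply is_RInt_ext. intros x _. unfold Im; simpl.
  replace (IZR l * x - PI / 2 + INR k * (PI / 2))
    with (- (PI / 2 - (IZR l * x + INR k * (PI / 2)))) by ring.
  rewrite cos_neg, cos_shift. ring.
Qed.

Lemma Cmod_le_Re_Im z : Cmod z <= Rabs (Re z) + Rabs (Im z).
Proof.
destruct z as [x y]. unfold Cmod, Re, Im; simpl fst; simpl snd.
pose proof (Rabs_pos x). pose proof (Rabs_pos y).
rewrite <- (sqrt_pow2 (Rabs x + Rabs y)) by lra.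
apply sqrt_le_1_alt. rewrite <- (pow2_abs x), <- (pow2_abs y). nra.
Qed.

(** * The dispersion relation *)

Lemma genP_trigonometric L a x :
  genP L a x = sum_n (fun k => let l := (Z.of_nat k - Z.of_nat L)%Z in
    Re (a l) * cos (IZR l * x) - Im (a l) * sin (IZR l * x)) (2 * L).
Proof.
unfold genP, gen_fun, zsum. generalize (2 * L)%nat as n. induction n as [|n IH].
- now rewrite !sum_O.
- rewrite !sum_Sn, <- IH. reflexivity.
Qed.

Lemma class_C_genP D n L a : class_C D n (genP L a).
Proof.
eapply class_C_ext; [intros x; symmetry; apply genP_trigonometric|].
apply class_C_sum. intros k. cbv zeta. set (l := (Z.of_nat k - Z.of_nat L)%Z).
apply (class_C_ext _ _ (fun x => Re (a l) * cos (IZR l * x + 0)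
  + - Im (a l) * cos (IZR l * x + - (PI / 2)))).
- intros x. rewrite Rplus_0_r.
  replace (IZR l * x + - (PI / 2)) with (- (PI / 2 - IZR l * x)) by ring.
  rewrite cos_neg, cos_shift. ring.
- apply class_C_plus; apply class_C_scal, class_C_cos_affine.
Qed.

Lemma genP_periodic L a x : genP L a (x + 2 * PI) = genP L a x.
Proof.
rewrite !genP_trigonometric. apply sum_n_ext. intros k. cbv zeta.
rewrite Rmult_plus_distr_l, (Rplus_comm (_ * x)).
now destruct (sin_cos_period (Z.of_nat k - Z.of_nat L)
  (IZR (Z.of_nat k - Z.of_nat L) * x)) as [-> ->].
Qed.

Lemma is_derive_periodic (f f' : R -> R) (T : R) :
  (forall x, is_derive f x (f' x)) -> (forall x, f (x + T) = f x) ->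
  forall x, f' (x + T) = f' x.
Proof.
intros Hd Hp x. rewrite <- (is_derive_unique _ _ _ (Hd x)). symmetry.
apply is_derive_unique. apply (is_derive_ext (fun x => f (x + T))); [exact Hp|].
replace (f' (x + T)) with (scal 1 (f' (x + T))) by apply Rmult_1_l.
apply (is_derive_comp f (fun x => x + T)); [apply Hd|].
auto_derive; [easy | ring].
Qed.

Lemma is_derive_genP L a x : is_derive (genP L a) x (Derive (genP L a) x).
Proof.
apply Derive_correct. destruct (class_C_genP everywhere 1 L a) as [f' [H _]].
exists (f' x). now apply H.
Qed.

Lemma Derive_genP_of_class L a D n :
  class_C D n (Derive (genP L a)).
Proof.
destruct (class_C_genP everywhere (S n) L a) as [f' [H H']].
apply (class_C_ext _ _ f').
- intros x. symmetry. apply is_derive_unique. now apply H.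
- now apply (class_C_restrict D everywhere).
Qed.

Lemma is_derive2_genP L a x :
  is_derive (Derive (genP L a)) x (Derive_n (genP L a) 2 x).
Proof.
apply Derive_correct. destruct (Derive_genP_of_class L a everywhere 1) as [f' [H _]].
exists (f' x). now apply H.
Qed.

Lemma continuous_Derive2_genP L a x : continuous (Derive_n (genP L a) 2) x.
Proof.
destruct (Derive_genP_of_class L a everywhere 1) as [f' [H H']].
apply (continuous_ext f'); [|now apply H'].
intros y. symmetry. apply is_derive_unique. now apply H.
Qed.

Lemma is_derive_dispersion L a alpha x :
  is_derive (fun x => genP L a x + alpha * x) x (Derive (genP L a) x + alpha).
Proof.
apply (is_derive_plus (V := R_NormedModule)); [apply is_derive_genP|].
auto_derive; [easy | ring].
Qed.

Lemma is_derive2_dispersion L a alpha x :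
  is_derive (fun x => Derive (genP L a) x + alpha) x (Derive_n (genP L a) 2 x).
Proof.
rewrite <- (Rplus_0_r (Derive_n (genP L a) 2 x)).
apply (is_derive_plus (V := R_NormedModule)); [apply is_derive2_genP|].
apply @is_derive_const.
Qed.

(** * Absence of stationary points *)

(** On the circle integration by parts has no boundary terms, so it can be
    repeated; each round turns [g] into the derivative of [g / phi']. *)
Lemma nonstationary_periodic (phi phi' : R -> R) (alpha : R) :
  (forall x, is_derive phi x (phi' x)) -> (forall n, class_C everywhere n phi') ->
  (forall x, phi' x <> 0) -> (forall x, phi (x + 2 * PI) = phi x + 2 * PI * alpha) ->
  forall n g, class_C everywhere n g -> (forall x, g (x + 2 * PI) = g x) ->
  exists c, forall t beta l, 0 < t -> t * alpha = IZR l ->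
    Rabs (RInt (fun x => g x * cos (t * phi x + beta)) 0 (2 * PI)) <= c / t ^ n.
Proof.
intros Hd Hs Hnz Hper. pose proof two_PI_pos as HP.
assert (Hcphi := fun x => is_derive_continuous _ _ _ (Hd x)).
assert (Hper' : forall x, phi' (x + 2 * PI) = phi' x).
{ intros x. rewrite <- (Rplus_0_r (phi' x)), <- (Rplus_0_r (phi' (x + 2 * PI))).
  apply Rplus_eq_reg_r with (- alpha).
  rewrite !Rplus_0_r.
  apply (is_derive_periodic (fun x => phi x + - alpha * x) (fun x => phi' x + - alpha)).
  - intros y. apply (is_derive_plus (V := R_NormedModule)); [apply Hd|].
    auto_derive; [easy | ring].
  - intros y. rewrite Hper. ring. }
induction n as [|n IH]; intros g Hg Hgp.
- exists (RInt (fun x => Rabs (g x)) 0 (2 * PI)). intros t beta l Ht _.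
  assert (Cc : forall x, continuous (fun x => g x * cos (t * phi x + beta)) x).
  { intros x. apply @continuous_mult; [now apply Hg | now apply continuous_cos_phase]. }
  simpl pow. rewrite Rdiv_1_r.
  eapply Rle_trans; [apply abs_RInt_le; [lra|]|].
  + apply @ex_RInt_continuous. auto.
  + apply RInt_le; [lra| | |].
    * apply @ex_RInt_continuous. intros x _.
      apply (continuous_comp _ Rabs); [apply Cc | apply continuous_Rabs].
    * apply @ex_RInt_continuous. intros x _.
      apply (continuous_comp g Rabs); [now apply Hg | apply continuous_Rabs].
    * intros x _. rewrite Rabs_mult. rewrite <- (Rmult_1_r (Rabs (g x))) at 2.
      apply Rmult_le_compat_l; [apply Rabs_pos | apply Rabs_le, COS_bound].
- set (B := fun x => g x / phi' x).
  assert (CB : class_C everywhere (S n) B) by (apply class_C_div; auto).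
  destruct CB as [B' [HB HB']].
  assert (HBp : forall x, B (x + 2 * PI) = B x).
  { intros x. unfold B. now rewrite Hgp, Hper'. }
  destruct (IH B' HB') as [c Hc].
  { apply (is_derive_periodic B); [|exact HBp]. intros x. now apply HB. }
  exists c. intros t beta l Ht Hl.
  assert (E : t * RInt (fun x => g x * cos (t * phi x + beta)) 0 (2 * PI) =
    - RInt (fun x => B' x * cos (t * phi x + (beta - PI / 2))) 0 (2 * PI)).
  { rewrite (RInt_ext _ (fun x => B x * phi' x * cos (t * phi x + beta))).
    2: { intros x _. replace (g x) with (B x * phi' x) by (unfold B; field; apply Hnz).
         reflexivity. }
    rewrite (oscillating_by_parts B B' phi phi').
    - rewrite <- (Rplus_0_l (2 * PI)) at 1 2. rewrite HBp, Hper.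
      replace (t * (phi 0 + 2 * PI * alpha) + beta)
        with (IZR l * (2 * PI) + (t * phi 0 + beta)) by (rewrite <- Hl; ring).
      rewrite (proj2 (sin_cos_period l _)). ring.
    - lra.
    - intros x _. split; [now apply HB | exact (class_C_continuous _ _ _ x HB' I)].
    - intros x _. split; [apply Hd | exact (class_C_continuous _ _ _ x (Hs 0%nat) I)]. }
  apply Rmult_le_reg_l with t; [exact Ht|].
  rewrite <- (Rabs_pos_eq t) at 1 by lra. rewrite <- Rabs_mult, E, Rabs_Ropp.
  replace (t * (c / t ^ S n)) with (c / t ^ n)
    by (simpl; field; split; [now apply pow_nonzero, Rgt_not_eq | lra]).
  now apply (Hc t (beta - PI / 2) l).
Qed.

(** * Finitely many stationary points *)

Lemma sum_1_S {G : AbelianMonoid} (f : nat -> G) K :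
  sum_n_m f 1 (S K) = plus (sum_n_m f 1 K) (f (S K)).
Proof. apply sum_n_Sm. lia. Qed.

Lemma sum_n_m_single (f : nat -> R) (K j : nat) :
  (1 <= j <= K)%nat -> (forall k, (1 <= k <= K)%nat -> k <> j -> f k = 0) ->
  sum_n_m f 1 K = f j.
Proof.
assert (Hz : forall K, (forall k, (1 <= k <= K)%nat -> f k = 0) -> sum_n_m f 1 K = 0).
{ clear. induction K as [|K IH]; intros H.
  - now rewrite sum_n_m_zero by lia.
  - rewrite sum_1_S, IH, H by (try lia; intros; apply H; lia). apply Rplus_0_l. }
induction K as [|K IH]; intros Hj H; [lia|]. rewrite sum_1_S.
destruct (Nat.eq_dec j (S K)) as [->|N].
- rewrite Hz; [apply Rplus_0_l|]. intros k Hk. apply H; lia.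
- rewrite (H (S K)), IH by (try lia; intros; apply H; lia). apply Rplus_0_r.
Qed.

Lemma sum_n_m_minus_R (f g : nat -> R) K :
  sum_n_m f 1 K - sum_n_m g 1 K = sum_n_m (fun k => f k - g k) 1 K.
Proof.
induction K as [|K IH].
- rewrite !sum_n_m_zero by lia. apply Rminus_0_r.
- rewrite !sum_1_S, <- IH. unfold plus; simpl. ring.
Qed.

(** The points [theta k] exhaust one period; together with their translates by
    [2 * PI] they account for the stationary points of the closed interval,
    whose ends are the same point of the circle. *)
Lemma stationary_points_jump L a alpha K theta (c : R -> R) x :
  stationary_points L a alpha K theta -> 0 <= x <= 2 * PI ->
  Derive (genP L a) x + alpha = 0 ->
  (forall y, Derive (genP L a) y + alpha = 0 -> y <> x -> c y = 0) ->
  sum_n_m (fun k => c (theta k) + c (theta k + 2 * PI)) 1 K = c x.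
Proof.
intros [Hst [Hinj Hall]] Hx Hx0 Hc. pose proof two_PI_pos as HP.
assert (Hper : forall y, Derive (genP L a) (y + 2 * PI) = Derive (genP L a) y).
{ apply (is_derive_periodic (genP L a)); [apply is_derive_genP | apply genP_periodic]. }
assert (Hst1 : forall k, (1 <= k <= K)%nat -> Derive (genP L a) (theta k) + alpha = 0).
{ intros k Hk. rewrite (proj2 (Hst k Hk)). ring. }
assert (Hst2 : forall k, (1 <= k <= K)%nat ->
  Derive (genP L a) (theta k + 2 * PI) + alpha = 0).
{ intros k Hk. rewrite Hper. now apply Hst1. }
assert (Hj : exists j, (1 <= j <= K)%nat /\ (theta j = x \/ theta j + 2 * PI = x)).
{ destruct (Rlt_dec x (2 * PI)) as [H|H].
  - destruct (Hall x) as [j [Hj E]]; [lra|lra|]. exists j. auto.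
  - destruct (Hall 0) as [j [Hj E]]; [lra| |].
    + rewrite <- Hper, Rplus_0_l. replace (2 * PI) with x by lra. lra.
    + exists j. split; [exact Hj|]. right. lra. }
destruct Hj as [j [Hj Ej]].
rewrite (sum_n_m_single _ K j Hj).
- pose proof (proj1 (Hst j Hj)). destruct Ej as [E|E].
  + rewrite E. rewrite (Hc (x + 2 * PI)); [apply Rplus_0_r| |lra].
    rewrite <- E. now apply Hst2.
  + rewrite E. rewrite (Hc (theta j)); [apply Rplus_0_l| |lra]. now apply Hst1.
- intros k Hk N. pose proof (proj1 (Hst j Hj)). pose proof (proj1 (Hst k Hk)).
  rewrite (Hc (theta k)), (Hc (theta k + 2 * PI)); [apply Rplus_0_l| | | |].
  + now apply Hst2.
  + intros E. apply N, Hinj; [exact Hk|exact Hj|]. lra.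
  + now apply Hst1.
  + intros E. apply N, Hinj; [exact Hk|exact Hj|]. lra.
Qed.

(** The Heaviside function with value [1 / 2] at its jump. *)
Definition half_heaviside (y : R) : R := (1 + sign y) / 2.

Lemma half_heaviside_pos y : 0 < y -> half_heaviside y = 1.
Proof. intros H. unfold half_heaviside. rewrite sign_eq_1 by exact H. field. Qed.

Lemma half_heaviside_neg y : y < 0 -> half_heaviside y = 0.
Proof. intros H. unfold half_heaviside. rewrite sign_eq_m1 by exact H. field. Qed.

Lemma half_heaviside_0 : half_heaviside 0 = / 2.
Proof. unfold half_heaviside. rewrite sign_0. field. Qed.

(** Each [theta k] and its translate by [2 * PI] enter the step function; between
    the two ends of the period exactly one full jump per [k] is collected, also
    when [theta k = 0] lies on the ends and contributes one half at each. *)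
Lemma stationary_phase_dispersion L a alpha K theta :
  stationary_points L a alpha K theta ->
  (forall k, (1 <= k <= K)%nat -> Derive_n (genP L a) 2 (theta k) <> 0) ->
  exists C, forall t beta l, 0 < t -> t * alpha = IZR l ->
    Rabs (RInt (fun x => cos (t * (genP L a x + alpha * x) + beta)) 0 (2 * PI)
      - sum_n_m (fun k => stationary_term (fun x => genP L a x + alpha * x)
                            (Derive_n (genP L a) 2) (theta k) t beta) 1 K) <= C / t.
Proof.
intros Hst Hnd. pose proof two_PI_pos as HP.
set (phi := fun x => genP L a x + alpha * x).
set (phi' := fun x => Derive (genP L a) x + alpha).
set (phi'' := Derive_n (genP L a) 2) in *.
assert (Hd1 : forall y, is_derive phi y (phi' y)) by exact (is_derive_dispersion L a alpha).
assert (Hd2 : forall y, is_derive phi' y (phi'' y)) by exact (is_derive2_dispersion L a alpha).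
assert (Hper' : forall y, phi' (y + 2 * PI) = phi' y).
{ intros y. unfold phi'. f_equal.
  exact (is_derive_periodic _ _ _ (is_derive_genP L a) (genP_periodic L a) y). }
assert (Hper'' : forall y, phi'' (y + 2 * PI) = phi'' y).
{ exact (is_derive_periodic phi' phi'' _ Hd2 Hper'). }
set (jump := fun x t beta p => half_heaviside (x - p) * stationary_term phi phi'' p t beta).
set (G := fun x t beta =>
  sum_n_m (fun k => jump x t beta (theta k) + jump x t beta (theta k + 2 * PI)) 1 K).
assert (EG : forall u x t beta, G u t beta - G x t beta =
  sum_n_m (fun k => (fun p => jump u t beta p - jump x t beta p) (theta k)
                  + (fun p => jump u t beta p - jump x t beta p) (theta k + 2 * PI)) 1 K).
{ intros u x t beta. unfold G. rewrite sum_n_m_minus_R.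
  apply sum_n_m_ext. intros k. cbv beta. simpl. ring. }
assert (Hst0 : forall k, (1 <= k <= K)%nat -> phi' (theta k) = 0).
{ intros k Hk. unfold phi'. rewrite (proj2 (proj1 Hst k Hk)). ring. }
assert (Hconst : forall x u p, x < u ->
  p < x \/ u < p -> half_heaviside (u - p) = half_heaviside (x - p)).
{ intros x u p Hxu [H|H].
  - rewrite !half_heaviside_pos by lra. reflexivity.
  - rewrite !half_heaviside_neg by lra. reflexivity. }
destruct (stationary_phase_interval phi phi' phi'' G 0 (2 * PI)) as [C HC].
- exact HP.
- apply class_C_plus; [apply class_C_genP|]. apply class_C_scal, class_C_id.
- exact Hd1.
- exact Hd2.
- exact (continuous_Derive2_genP L a).
- intros x Hx Hx0. destruct (Rlt_dec x (2 * PI)) as [H|H].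
  + destruct (proj2 (proj2 Hst) x) as [j [Hj <-]]; [lra|unfold phi' in Hx0; lra|].
    now apply Hnd.
  + assert (E : x = 0 + 2 * PI) by lra. rewrite E in Hx0 |- *.
    rewrite Hper' in Hx0. rewrite Hper''.
    destruct (proj2 (proj2 Hst) 0) as [j [Hj Ej]]; [lra|unfold phi' in Hx0; lra|].
    intros Z. apply (Hnd j Hj). now rewrite Ej.
- intros x u Hxu Hn t beta. unfold G. apply sum_n_m_ext_loc. intros k Hk.
  assert (Hp : forall p, phi' p = 0 -> jump u t beta p = jump x t beta p).
  { intros p Hp0. unfold jump. f_equal. apply Hconst; [exact Hxu|].
    destruct (Rlt_dec p x); [now left|]. destruct (Rlt_dec u p); [now right|].
    exfalso. apply (Hn p); [lra | exact Hp0]. }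
  rewrite !Hp; [reflexivity| |]; rewrite ?Hper'; now apply Hst0.
- intros x u Hx Hx0 Hxu Hn t beta. rewrite EG.
  rewrite (stationary_points_jump L a alpha K theta
    (fun p => jump u t beta p - jump x t beta p) x Hst Hx Hx0).
  + unfold jump. rewrite half_heaviside_pos by lra.
    rewrite (Rminus_diag x), half_heaviside_0. field.
  + intros p Hp0 Hpx. cbv beta. unfold jump. rewrite (Hconst x u); [ring|exact Hxu|].
    destruct (Rlt_dec p x); [now left|]. destruct (Rlt_dec u p); [now right|].
    exfalso. apply (Hn p); [lra | exact Hp0].
- intros x u Hx Hx0 Hux Hn t beta. rewrite EG.
  rewrite (stationary_points_jump L a alpha K theta
    (fun p => jump x t beta p - jump u t beta p) x Hst Hx Hx0).
  + unfold jump. rewrite (half_heaviside_neg (u - x)) by lra.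
    rewrite (Rminus_diag x), half_heaviside_0. field.
  + intros p Hp0 Hpx. cbv beta. unfold jump. rewrite (Hconst u x); [ring|exact Hux|].
    destruct (Rlt_dec p u); [now left|]. destruct (Rlt_dec x p); [now right|].
    exfalso. apply (Hn p); [lra | exact Hp0].
- exists C. intros t beta l Ht Hl. specialize (HC t beta Ht).
  rewrite EG in HC.
  rewrite (sum_n_m_ext_loc _ (fun k => stationary_term phi phi'' (theta k) t beta)) in HC;
    [exact HC|].
  intros k Hk. pose proof (proj1 (proj1 Hst k Hk)).
  assert (E : stationary_term phi phi'' (theta k + 2 * PI) t beta
    = stationary_term phi phi'' (theta k) t beta).
  { unfold stationary_term. rewrite Hper''. f_equal.
    unfold phi. rewrite genP_periodic.
    rewrite <- (proj1 (sin_cos_period l (t * (genP L a (theta k) + alpha * theta k) + _ + _))).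
    f_equal. rewrite <- Hl. ring. }
  unfold jump. rewrite E.
  rewrite (half_heaviside_pos (2 * PI - theta k)),
    (half_heaviside_neg (0 - (theta k + 2 * PI))) by lra.
  replace (2 * PI - (theta k + 2 * PI)) with (0 - theta k) by ring. simpl. ring.
Qed.

(** * The asymptotic formula *)

Lemma leading_term_components L a alpha K theta t :
  0 < t -> (forall k, (1 <= k <= K)%nat -> Derive_n (genP L a) 2 (theta k) <> 0) ->
  let tau := fun beta k => stationary_term (fun x => genP L a x + alpha * x)
                             (Derive_n (genP L a) 2) (theta k) t beta in
  2 * PI * Re (leading_term L a alpha K theta t) = sum_n_m (tau 0) 1 K /\
  2 * PI * Im (leading_term L a alpha K theta t) = sum_n_m (tau (- (PI / 2))) 1 K.
Proof.
intros Ht Hnd tau. unfold leading_term.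
assert (Hc : forall k, (1 <= k <= K)%nat ->
  sqrt (2 * PI / (Rabs (Derive_n (genP L a) 2 (theta k)) * t)) =
  2 * PI * (1 / sqrt (2 * PI * t)) * (1 / sqrt (Rabs (Derive_n (genP L a) 2 (theta k))))).
{ intros k Hk. pose proof two_PI_pos as HP.
  assert (Hm := Rabs_pos_lt _ (Hnd k Hk)). set (m := Rabs _) in *.
  assert (H1 : 0 < 2 * PI * t) by now apply Rmult_lt_0_compat.
  pose proof (sqrt_lt_R0 _ H1). pose proof (sqrt_lt_R0 _ Hm).
  apply sqrt_lem_1.
  - left. apply Rdiv_lt_0_compat; [lra|]. now apply Rmult_lt_0_compat.
  - left. apply Rmult_lt_0_compat; [apply Rmult_lt_0_compat|]; try lra;
      apply Rdiv_lt_0_compat; lra.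
  - transitivity ((2 * PI) ^ 2 / (sqrt (2 * PI * t) ^ 2 * sqrt m ^ 2)); [field; lra|].
    rewrite !pow2_sqrt by lra. field. pose proof PI_RGT_0. lra. }
induction K as [|K IH].
- rewrite !sum_n_m_zero by lia. split; unfold Re, Im, zero; simpl; ring.
- destruct IH as [IHr IHi].
  { intros k Hk. apply Hnd. lia. }
  { intros k Hk. apply Hc. lia. }
  rewrite !sum_1_S, <- IHr, <- IHi. clear IHr IHi.
  unfold tau, stationary_term. rewrite !Hc by lia. cbv beta.
  rewrite Rplus_0_r.
  set (ph := t * _).
  set (sg := sign _ * _).
  replace (ph + - (PI / 2) + sg) with (- (PI / 2 - (ph + sg))) by ring.
  rewrite cos_neg, cos_shift.
  match goal with |- context [plus ?A ?B] => set (S := A) end.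
  split; unfold plus; simpl; unfold Cplus, Cmult, Re, Im, expi; simpl; ring.
Qed.

Lemma amplitude_dispersion_integral L X a alpha l t :
  isotropic X a -> t * alpha = IZR l ->
  let I := fun beta =>
    RInt (fun x => cos (t * (genP L a x + alpha * x) + beta)) 0 (2 * PI) in
  2 * PI * Re (amplitude L X l t) = I 0 /\
  2 * PI * Im (amplitude L X l t) = I (- (PI / 2)).
Proof.
intros Hiso Hl I.
destruct (amplitude_integral L X a l t Hiso) as [-> ->].
{ intros x. exact (is_derive_continuous _ _ _ (is_derive_genP L a x)). }
split; apply RInt_ext; intros x _; f_equal; rewrite <- Hl; ring.
Qed.

Lemma Cmod_le_of_components (z : C) (e : R) :
  Rabs (2 * PI * Re z) <= e -> Rabs (2 * PI * Im z) <= e -> Cmod z <= e / PI.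
Proof.
pose proof two_PI_pos as HP.
rewrite (Rabs_mult _ (Re z)), (Rabs_mult _ (Im z)), (Rabs_pos_eq (2 * PI)) by lra.
intros H1 H2.
eapply Rle_trans; [apply Cmod_le_Re_Im|].
apply Rmult_le_reg_l with (2 * PI); [exact HP|].
replace (2 * PI * (e / PI)) with (2 * e) by (field; lra). lra.
Qed.

Theorem theorem1p1 (L : nat) (X : Z -> Z -> C) (a : Z -> C)
    (Hherm : hermitian X) (Hsupp : finite_support X L) (Hiso : isotropic X a)
    (alpha : R) :
  (forall (K : nat) (theta : nat -> R),
     (0 < K)%nat ->
     stationary_points L a alpha K theta ->
     (forall k, (1 <= k <= K)%nat -> Derive_n (genP L a) 2 (theta k) <> 0) ->
     exists M T : R, forall (t : R) (l : Z),
       0 < t -> T <= t -> alpha = IZR l / t ->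
       Cmod (Cminus (amplitude L X l t) (leading_term L a alpha K theta t))
         <= M / t)
  /\
  ((forall x : R, Derive (genP L a) x <> - alpha) ->
   forall n : nat, exists c : R, forall (t : R) (l : Z),
     0 < t -> alpha = IZR l / t ->
     Cmod (amplitude L X l t) <= c / t ^ n).
Proof.
assert (Hl : forall t l, 0 < t -> alpha = IZR l / t -> t * alpha = IZR l).
{ intros t l Ht ->. field. lra. }
split.
- intros K theta _ Hst Hnd.
  destruct (stationary_phase_dispersion L a alpha K theta Hst Hnd) as [C HC].
  exists (C / PI), 0. intros t l Ht _ Ha.
  destruct (amplitude_dispersion_integral L X a alpha l t Hiso (Hl t l Ht Ha)) as [Er Ei].
  destruct (leading_term_components L a alpha K theta t Ht Hnd) as [Lr Li].
  replace (C / PI / t) with (C / t / PI) by (field; pose proof PI_RGT_0; lra).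
  apply Cmod_le_of_components.
  + replace (2 * PI * Re _) with (2 * PI * Re (amplitude L X l t)
      - 2 * PI * Re (leading_term L a alpha K theta t)) by (unfold Re; simpl; ring).
    rewrite Er, Lr. now apply (HC t 0 l); [|apply Hl].
  + replace (2 * PI * Im _) with (2 * PI * Im (amplitude L X l t)
      - 2 * PI * Im (leading_term L a alpha K theta t)) by (unfold Im; simpl; ring).
    rewrite Ei, Li. now apply (HC t _ l); [|apply Hl].
- intros Hns n.
  destruct (nonstationary_periodic (fun x => genP L a x + alpha * x)
    (fun x => Derive (genP L a) x + alpha) alpha) with (n := n) (g := fun _ : R => 1)
    as [c Hc].
  + apply is_derive_dispersion.
  + intros m. apply class_C_plus; [apply Derive_genP_of_class | apply class_C_const].
  + intros x E. apply (Hns x). lra.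
  + intros x. rewrite genP_periodic. ring.
  + apply class_C_const.
  + reflexivity.
  + exists (c / PI). intros t l Ht Ha.
    destruct (amplitude_dispersion_integral L X a alpha l t Hiso (Hl t l Ht Ha)) as [Er Ei].
    replace (c / PI / t ^ n) with (c / t ^ n / PI)
      by (field; pose proof PI_RGT_0; pose proof (pow_lt t n Ht); lra).
    assert (Hint : forall beta, Rabs (RInt (fun x =>
      cos (t * (genP L a x + alpha * x) + beta)) 0 (2 * PI)) <= c / t ^ n).
    { intros beta.
      rewrite (RInt_ext _ (fun x => 1 * cos (t * (genP L a x + alpha * x) + beta)))
        by (intros; symmetry; apply Rmult_1_l).
      exact (Hc t beta l Ht (Hl t l Ht Ha)). }
    apply Cmod_le_of_components; [rewrite Er | rewrite Ei]; apply Hint.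
Qed.
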